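(* For every $t \in \mathbb{N}$ there is a constant $B_t > 0$ depending only on $t$ such that for every $n$ with $t < n/2$ there exist real numbers $x_1,\dots,x_F$ with $\max_j |x_j| \leq B_t/(2n-2)!!$ such that the matrix $\widetilde{A} = \sum_{j=1}^F x_j A_{\rho^{(j)}}$ has eigenvalues on the eigenspaces $2\lambda^{(1)},\dots,2\lambda^{(F)}$ given by \[\eta_i = \sum_{j=1}^F x_j P_{\lambda^{(i)},\rho^{(j)}} = \begin{cases} 1 & \text{if } i = 1,\\ \zeta & \text{if } 1 < i \leq F.\end{cases}\]
   Context: $\mathcal{M}_{2n}$ is the set of perfect matchings of $K_{2n}$. For $m,m'\in\mathcal{M}_{2n}$ the multigraph union $m\cup m'$ is a disjoint union of even cycles (a common edge is a $2$-cycle); listing cycle lengths as $2\rho_1\ge2\rho_2\ge\dots$ gives the cycle type $d(m,m')=\rho\vdash n$. For $\rho \vdash n$ the associate $A_\rho$ is the $\mathcal{M}_{2n}\times\mathcal{M}_{2n}$ 0/1 matrix with $(A_\rho)_{m,m'}=1$ iff $d(m,m')=\rho$. The permutation module $\mathbb{R}[\mathcal{M}_{2n}]$ of $S_{2n}$ decomposes multiplicity-freely as $\bigoplus_{\lambda\vdash n} S^{2\lambda}$ where $2\lambda=(2\lambda_1,2\lambda_2,\dots)$; each $S^{2\lambda}$ is an eigenspace of every $A_\rho$, and $P_{\lambda,\rho}$ denotes the eigenvalue of $A_\rho$ on $S^{2\lambda}$. Partitions of $n$ are ordered reverse-lexicographically ($\mu\le\lambda$ iff $\mu=\lambda$ or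 $\mu_j<\lambda_j$ at the first differing index $j$); $\lambda\vdash n$ is fat if $\lambda\ge(n-t,1^t)$. $F_t$ is the number of fat partitions of $n$ (which depends only on $t$ for $t<n/2$), $F = F_t-1$, and $\lambda^{(1)} > \lambda^{(2)} > \dots > \lambda^{(F)}$ and $\rho^{(1)} > \dots > \rho^{(F)}$ both denote the first $F$ partitions of $n$ in reverse-lexicographic order (i.e. the fat partitions other than $(n-t,1^t)$). $\zeta = -1/\big((2n-1)(2n-3)\cdots(2n-2t+1) - 1\big)$, and $(2k)!! = 2^k k!$. *)

(* Defs.v *)
From HB Require Import structures.
From mathcomp Require Import all_boot all_order all_algebra all_fingroup.
From mathcomp Require Import reals.
Set Implicit Arguments. Unset Strict Implicit. Unset Printing Implicit Defensive.
Import Order.TTheory GRing.Theory Num.Theory.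
Local Open Scope ring_scope.

(* A perfect matching of K_{2n} on vertex set 'I_(2n) is encoded as the
   fixed-point-free involution sending each vertex to its partner. *)
Definition is_pmb (n : nat) (s : {perm 'I_(n.*2)}) : bool :=
  [forall x, (s (s x) == x) && (s x != x)].

Definition matching (n : nat) := {s : {perm 'I_(n.*2)} | is_pmb s}.

(* a partition of n, padded with zeros to n parts *)
Definition partb (n : nat) (l : {ffun 'I_n -> 'I_n.+1}) : bool :=
  [forall i : 'I_n, forall j : 'I_n, ((i <= j)%N ==> (l j <= l i)%N)]
  && ((\sum_(i < n) (l i : nat))%N == n).

Definition part (n : nat) := {l : {ffun 'I_n -> 'I_n.+1} | partb l}.

Definition pv (n : nat) (l : part n) (i : 'I_n) : nat := val l i.

Definition ptoseq (n : nat) (l : part n) : seq nat :=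
  [seq pv l i | i <- enum 'I_n & (0 < pv l i)%N].

Definition revlex_lt (n : nat) (a b : 'I_n -> nat) : bool :=
  [exists i : 'I_n, (a i < b i)%N &&
     [forall j : 'I_n, (j < i)%N ==> (a j == b j)]].

Definition hookp (n t : nat) (i : 'I_n) : nat :=
  if (i == 0 :> nat) then (n - t)%N else if (i <= t)%N then 1%N else 0%N.

(* lambda is fat and different from the hook, i.e. lambda > (n-t,1^t);
   these are exactly lambda^(1),...,lambda^(F) (= rho^(1),...,rho^(F)) *)
Definition fatp (n t : nat) (l : part n) : bool := revlex_lt (@hookp n t) (pv l).

Definition is_row (n : nat) (l : part n) : bool :=
  [forall i : 'I_n, pv l i == (if (i == 0 :> nat) then n else 0%N)].

Definition union_rel (n : nat) (m m' : matching n) : rel 'I_(n.*2) :=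
  fun x y => (y == val m x) || (y == val m' x).

Definition union_comps (n : nat) (m m' : matching n) : {set {set 'I_(n.*2)}} :=
  [set [set y | connect (union_rel m m') x y] | x : 'I_(n.*2)].

(* components of m \cup m' have 2 rho_i vertices; list rho nonincreasingly *)
Definition cycle_type (n : nat) (m m' : matching n) : seq nat :=
  sort geq [seq (#|C| %/ 2)%N | C : {set 'I_(n.*2)} <- enum (union_comps m m')].

Definition Aassoc (R : realType) (n : nat) (r : part n) (m m' : matching n) : R :=
  if cycle_type m m' == ptoseq r then 1 else 0.

(* g . m : the matching with edges {g a, g b} for {a,b} in m *)
Definition act (n : nat) (g : {perm 'I_(n.*2)}) (m : matching n) : matching n :=
  insubd m (g^-1 * val m * g)%g.

Definition rep (R : realType) (n : nat) (g : {perm 'I_(n.*2)})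
  (v : matching n -> R) : matching n -> R := fun m => v (act g^-1 m).

(* Young tableau of shape 2 lambda, filled row by row with 0..2n-1 *)
Definition psum (n : nat) (l : part n) (r : nat) : nat :=
  (\sum_(i < n | (i < r)%N) (pv l i).*2)%N.
Definition rowof (n : nat) (l : part n) (k : 'I_(n.*2)) : nat :=
  #|[set i : 'I_n | (psum l i.+1 <= k)%N]|.
Definition colof (n : nat) (l : part n) (k : 'I_(n.*2)) : nat :=
  (k - psum l (rowof l k))%N.

Definition rowstab (n : nat) (l : part n) (p : {perm 'I_(n.*2)}) : bool :=
  [forall k, rowof l (p k) == rowof l k].
Definition colstab (n : nat) (l : part n) (q : {perm 'I_(n.*2)}) : bool :=
  [forall k, colof l (q k) == colof l k].

Definition ysym (R : realType) (n : nat) (l : part n) (w : matching n -> R)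
  : matching n -> R := fun m =>
  \sum_(p | rowstab l p) \sum_(q | colstab l q)
     (-1) ^+ (odd_perm q) * rep p (rep q w) m.

(* v lies in the isotypic component S^{2 lambda} of R[M_{2n}], i.e. in the
   span of { g . e_T . w }. *)
Definition inS (R : realType) (n : nat) (l : part n) (v : matching n -> R) : Prop :=
  exists f : {perm 'I_(n.*2)} -> (matching n -> R),
    forall m, v m = \sum_g rep g (ysym l (f g)) m.

Definition Atilde (R : realType) (n t : nat) (x : part n -> R)
  (v : matching n -> R) : matching n -> R := fun m =>
  \sum_(r | fatp t r) x r * \sum_m' @Aassoc R n r m m' * v m'.

Definition zeta (R : realType) (n t : nat) : R :=
  - ((\prod_(i < t) (n.*2 - i.*2 - 1)%:R) - 1)^-1.

Definition eta_target (R : realType) (n t : nat) (l : part n) : R :=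
  if is_row l then 1 else zeta R n t.

(* (2k)!! = 2^k k! *)
Definition dfact2 (k : nat) : nat := (2 ^ k * k`!)%N.

(* Main.v *)
(** Row labellings [r] of the vertices stand for the Young subgroups preserving their fibres, and
    [f_r] denotes the indicator of the matchings all of whose edges lie inside rows of [r].

    Let [D = Atilde - zeta I - (1 - zeta) J / |M|].  If [x] is chosen so that [<f_r, D f_r> = 0]
    for every [r] of fat shape, then [D] kills every [r]-invariant function [g], by induction from
    the largest shapes down.  Indeed [u = D g] is [r]-invariant, and moving a vertex [b] to
    another row at least as large gives a larger shape, so [u + sum_a u o (a b) = 0], [a] ranging
    over that row.  Applied to an edge joining two rows, this Garnir relation expresses [u m]
    through matchings with more edges inside rows; hence [u] is determined by its constant value on
    the support of [f_r], which vanishes by self-adjointness of [D], first for [g = f_r] and then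
    in general.  Vectors in [S^{2 lambda}] are generated by row-invariant ones, and the all-ones
    matrix [J] kills them unless [lambda = (n)].

    The equations [<f_r, D f_r> = 0] read
    [sum_rho x_rho K(r, rho) = zeta a + (1 - zeta) a^2 / |M|], where [a] is the number of matchings
    refining [r] and [K(r, rho)] counts the pairs of such matchings of cycle type [rho].  A
    nonzero [K(r, rho)] forces [rho] to be the shape of [r] or to have more parts, so the system is
    triangular and is solved in at most [t + 1] steps.  If the largest row has [2N] vertices, then
    [K(r, shape r) >= a (2N-2)!!], whereas the [K(r, rho)] with [rho] fat add up to at most
    [C_t a (2N-2)!!]; both estimates follow the walk [w_(i+1) = m (m' w_i)], which has
    [2N - 2i - 2] possible continuations as long as it has not closed up. *)
From HB Require Import structures.
From mathcomp Require Import all_boot all_order all_algebra all_fingroup.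
From mathcomp Require Import reals zify ring lra.
(* Loaded after [all_fingroup], whose group actions also export the name [act]. *)
Require Import Defs.
Set Implicit Arguments. Unset Strict Implicit. Unset Printing Implicit Defensive.
Import Order.TTheory GRing.Theory Num.Theory.
Local Open Scope ring_scope.

(** * Matchings and the action of the symmetric group *)

Lemma matchingK n (m : matching n) : involutive (val m).
Proof. by move=> x; case/andP: (forallP (valP m) x) => /eqP. Qed.

Lemma matching_neq n (m : matching n) x : val m x != x.
Proof. by case/andP: (forallP (valP m) x). Qed.

Lemma matching_sym n (m : matching n) x y : (val m x == y) = (val m y == x).
Proof. by apply/eqP/eqP => <-; rewrite matchingK. Qed.

Lemma matching_eqP n (m m' : matching n) : (forall x, val m x = val m' x) -> m = m'.
Proof. by move=> e; apply/val_inj/permP. Qed.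

Lemma matching_of_invol n (f : 'I_(n.*2) -> 'I_(n.*2)) :
  involutive f -> (forall x, f x != x) ->
  exists m : matching n, forall x, val m x = f x.
Proof.
move=> fK fN.
have h : is_pmb (perm (inv_inj fK)).
  by apply/forallP => x; rewrite !permE fK eqxx fN.
pose m : matching n := exist (fun s => is_pmb s) _ h.
by exists m => x; rewrite /= permE.
Qed.

(** Conjugation preserves fixed-point-free involutions, so [insubd] never falls back on its default
    [m]. *)
Lemma val_act n (g : {perm 'I_(n.*2)}) (m : matching n) :
  val (act g m) = (g^-1 * val m * g)%g.
Proof.
rewrite val_insubd; case: ifP => // /negP []; apply/forallP => x.
rewrite !permM permK matchingK permKV eqxx /=.
by rewrite -{2}(permKV g x) (inj_eq perm_inj) matching_neq.
Qed.

Lemma actE n (g : {perm 'I_(n.*2)}) (m : matching n) x :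
  val (act g m) x = g (val m (g^-1%g x)).
Proof. by rewrite val_act !permM. Qed.

Lemma actEg n (g : {perm 'I_(n.*2)}) (m : matching n) x :
  val (act g m) (g x) = g (val m x).
Proof. by rewrite actE permK. Qed.

Lemma act_id n (m : matching n) : act 1%g m = m.
Proof. by apply/val_inj; rewrite val_act invg1 mul1g mulg1. Qed.

Lemma actM n (g h : {perm 'I_(n.*2)}) (m : matching n) :
  act (g * h)%g m = act h (act g m).
Proof. by apply/val_inj; rewrite !val_act invMg !mulgA. Qed.

Lemma actK n (g : {perm 'I_(n.*2)}) : cancel (@act n g) (act g^-1%g).
Proof. by move=> m; rewrite -actM mulgV act_id. Qed.

Lemma actKV n (g : {perm 'I_(n.*2)}) : cancel (@act n g^-1%g) (act g).
Proof. by move=> m; rewrite -actM mulVg act_id. Qed.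

Lemma act_inj n (g : {perm 'I_(n.*2)}) : injective (@act n g).
Proof. exact: can_inj (@actK n g). Qed.

Lemma union_relC n (m m' : matching n) : union_rel m m' =2 union_rel m' m.
Proof. by move=> x y; rewrite /union_rel orbC. Qed.

Lemma cycle_typeC n (m m' : matching n) : cycle_type m m' = cycle_type m' m.
Proof.
rewrite /cycle_type; suff -> : union_comps m m' = union_comps m' m by [].
by apply: eq_imset => x; apply/setP=> y; rewrite !inE (eq_connect (@union_relC n m m')).
Qed.

Lemma connect_act n (g : {perm 'I_(n.*2)}) (m m' : matching n) x y :
  connect (union_rel (act g m) (act g m')) (g x) (g y) = connect (union_rel m m') x y.
Proof.
have h k (a b : matching n) x1 y1 : connect (union_rel a b) x1 y1 ->
   connect (union_rel (act k a) (act k b)) (k x1) (k y1).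
  case/connectP => p hp ->; elim: p x1 hp => //= z p IH x1 /andP[hz hp].
  apply: connect_trans (IH _ hp); apply: connect1.
  by rewrite /union_rel !actEg !(inj_eq perm_inj).
apply/idP/idP; last exact: h.
by move=> /(h g^-1%g); rewrite !actK !permK.
Qed.

(** [g] maps the components of the union bijectively onto those of the translated union and keeps
    their sizes. The two enumerations agree only up to order, which sorting removes. *)
Lemma cycle_type_act n (g : {perm 'I_(n.*2)}) (m m' : matching n) :
  cycle_type (act g m) (act g m') = cycle_type m m'.
Proof.
rewrite /cycle_type; apply/perm_sortP.
- by move=> a b; rewrite /geq /= leq_total.
- by move=> a b c /= h1 h2; apply: leq_trans h2 h1.
- by move=> a b; rewrite /geq /= -eqn_leq => /eqP.
have inj : injective (fun C : {set 'I_(n.*2)} => g @: C) by apply: imset_inj; apply: perm_inj.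
have -> : union_comps (act g m) (act g m') =
   (fun C : {set 'I_(n.*2)} => g @: C) @: union_comps m m'.
  rewrite /union_comps -imset_comp; apply/setP => C.
  have step x : [set y | connect (union_rel (act g m) (act g m')) (g x) y] =
        g @: [set y | connect (union_rel m m') x y].
    apply/setP=> y; rewrite -[y](permKV g) mem_imset ?inE ?connect_act //.
    exact: perm_inj.
  apply/imsetP/imsetP => -[x _ ->].
  - by exists (g^-1%g x) => //=; rewrite -step permKV.
  - by exists (g x) => //=; rewrite step.
pose G (C : {set 'I_(n.*2)}) := g @: C.
have hp : perm_eq (enum (G @: union_comps m m')) [seq G C | C <- enum (union_comps m m')].
  apply: uniq_perm; rewrite ?enum_uniq ?(map_inj_uniq inj) ?enum_uniq // => C.
  rewrite mem_enum; apply/imsetP/mapP => -[D hD ->]; exists D => //.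
    by rewrite mem_enum.
  by rewrite -mem_enum.
apply: perm_trans (perm_map _ hp) _; rewrite -map_comp.
have -> : [seq ((fun C : {set 'I_(n.*2)} => (#|C| %/ 2)%N) \o G) i | i <- enum (union_comps m m')]
  = [seq (#|C| %/ 2)%N | C : {set 'I_(n.*2)} <- enum (union_comps m m')].
  by apply: eq_map => C; rewrite /= /G card_imset //; apply: perm_inj.
exact: perm_refl.
Qed.

(** * Row-invariant functions and Garnir relations *)

Definition refines n (r : 'I_(n.*2) -> 'I_(n.*2)) (m : matching n) : bool :=
  [forall x, r (val m x) == r x].

(** A label that is not attained gives an empty row, so sums over rows may range over all labels. *)
Definition row n (r : 'I_(n.*2) -> 'I_(n.*2)) (i : 'I_(n.*2)) : {set 'I_(n.*2)} :=
  [set x | r x == i].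

(** The counterpart of [fatp] for labellings. The bound on the number of rows excludes the hook (n -
    t, 1^t), which has t + 1 parts. *)
Definition wide n t (r : 'I_(n.*2) -> 'I_(n.*2)) : bool :=
  [exists x, ((n - t).*2 <= #|row r (r x)|)%N &&
     (((n - t).*2 < #|row r (r x)|)%N || (#|[set r x | x in setT]| <= t)%N)].

Definition row_invariant (R : Type) n (r : 'I_(n.*2) -> 'I_(n.*2)) (u : matching n -> R) :=
  forall h : {perm 'I_(n.*2)}, (forall x, r (h x) = r x) ->
  forall m, u (act h m) = u m.

Definition move_to n (r : 'I_(n.*2) -> 'I_(n.*2)) b i :=
  fun x => if x == b then i else r x.

(** Once [g] itself is counted as the term [a = b], the transpositions [tperm a b] represent the
    cosets of the stabiliser of [b] in the Young subgroup of the new rows. A permutation preserving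
    the new rows only permutes these cosets. *)
Lemma move_to_invariant (R : nmodType) n (r : 'I_(n.*2) -> 'I_(n.*2)) b i
    (g : matching n -> R) :
  r b != i -> row_invariant r g ->
  row_invariant (move_to r b i)
    (fun m => g m + \sum_(a | r a == i) g (act (tperm a b) m)).
Proof.
move=> bi gr h hh m.
have E m1 : g m1 + \sum_(a | r a == i) g (act (tperm a b) m1)
    = \sum_(a | move_to r b i a == i) g (act (tperm a b) m1).
  rewrite [RHS](bigD1 b) /=; last by rewrite /move_to eqxx.
  rewrite tperm1 act_id; congr (_ + _); apply: eq_bigl => a.
  rewrite /move_to; case: (altP (a =P b)) => [->|ab]; last by rewrite andbT.
  by rewrite (negbTE bi) andbF.
rewrite !E (reindex_inj (@perm_inj _ h)) /=; apply: eq_big => [a|a]; first by rewrite hh.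
rewrite hh => /eqP ra.
have -> : act (tperm (h a) b) (act h m) =
    act (tperm a b * h * tperm (h a) b)%g (act (tperm a b) m).
  by rewrite -!actM !mulgA tperm2 mul1g.
(* [k] fixes [b] and preserves the new rows, so it preserves the rows of [r] as well. *)
apply: gr => x; set k := (_ * _ * _)%g.
have kb : k b = b by rewrite /k !permM tpermR tpermL.
have [->|xb] := altP (x =P b); first by rewrite kb.
have rt c y : move_to r b i c = i -> move_to r b i (tperm c b y) = move_to r b i y.
  by move=> hc; case: tpermP => // ->; rewrite hc /move_to eqxx.
have: move_to r b i (k x) = move_to r b i x.
  by rewrite /k !permM rt ?hh ?rt // hh.
by rewrite /move_to -{1}kb (inj_eq perm_inj) (negbTE xb).
Qed.

(* Swapping [m x] with [m' x] inside their common row makes [m] agree with [m'] at one more edge. *)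
Lemma row_invariant_refines (R : Type) n (r : 'I_(n.*2) -> 'I_(n.*2)) (u : matching n -> R)
    (m m' : matching n) :
  row_invariant r u -> refines r m -> refines r m' -> u m = u m'.
Proof.
move=> ur; move: {2}_.+1 (ltnSn #|[set x | val m x != val m' x]|) => N.
elim: N m => // N IH m hN rm rm'.
have [/eqP d0|/set0Pn[x]] := boolP ([set x | val m x != val m' x] == set0).
  congr u; apply: matching_eqP => x; apply/eqP/negPn/negP => hx.
  by have := in_set0 x; rewrite -d0 inE hx.
rewrite inE => hx; pose g := tperm (val m x) (val m' x).
have rx : r (val m x) = r (val m' x).
  by rewrite (eqP (forallP rm x)) (eqP (forallP rm' x)).
have rg y : r (g y) = r y by rewrite /g; case: tpermP => // ->.
have gx : g x = x.
  by rewrite /g tpermD // matching_neq.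
rewrite -(ur g rg m); apply: IH => //; last first.
  apply/forallP => y; rewrite -[y](permKV g) actEg !rg.
  exact: (forallP rm).
rewrite -ltnS (leq_trans _ hN) // ltnS; apply: proper_card; apply/properP; split; last first.
  exists x; rewrite !inE // negbK -{1}gx actEg /g tpermL //.
apply/subsetP => y; rewrite !inE; apply: contra => /eqP e.
have gV : g^-1%g = g by rewrite /g tpermV.
have [ymx|ymx] := altP (y =P val m x).
  by rewrite ymx matchingK in e; rewrite -(inj_eq (@perm_inj _ (val m'))) matchingK -e eqxx in hx.
have [ymx'|ymx'] := altP (y =P val m' x).
  rewrite actE gV ymx' tpermR matchingK gx matchingK //.
have gy : g y = y by rewrite /g tpermD // eq_sym.
rewrite actE gV gy e; apply/eqP; rewrite /g tpermD //.
  rewrite -e (inj_eq perm_inj); apply/negP => /eqP xy.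
  by move: hx; rewrite xy e eqxx.
rewrite (inj_eq perm_inj); apply/negP => /eqP xy.
by move: hx; rewrite xy e eqxx.
Qed.

(** The size condition keeps only the moves that enlarge the shape, for which an induction
    hypothesis will be available. *)
Definition garnir (R : nmodType) n (r : 'I_(n.*2) -> 'I_(n.*2)) (u : matching n -> R) :=
  forall b c, r b != r c -> (#|row r (r b)| <= #|row r (r c)|)%N ->
  forall m, u m + \sum_(a | r a == r c) u (act (tperm a b) m) = 0.

(* For an edge {b, c} between two rows, the terms of the Garnir relation in which the
   number of edges inside rows does not increase are all equal to [u m], with positive total
   coefficient. *)
Lemma garnir_eq0 (R : realFieldType) n (r : 'I_(n.*2) -> 'I_(n.*2)) (u : matching n -> R) :
  row_invariant r u -> garnir r u ->
  (forall m, refines r m -> u m = 0) -> forall m, u m = 0.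
Proof.
move=> ur ug u0 m; move: {2}_.+1 (ltnSn #|[set x | r (val m x) != r x]|) => N.
elim: N m => // N IH m hN.
have [/eqP d0|/set0Pn[x0]] := boolP ([set x | r (val m x) != r x] == set0).
  apply: u0; apply/forallP => x; apply/negPn/negP => hx.
  by have := in_set0 x; rewrite -d0 inE hx.
rewrite inE => hx0.
(* Of the two endpoints of a crossing edge, [b] is one whose row is not the larger. *)
have [b [rbc hle]] : exists b, r b != r (val m b) /\
    (#|row r (r b)| <= #|row r (r (val m b))|)%N.
  case: (leqP #|row r (r x0)| #|row r (r (val m x0))|) => h.
    by exists x0; rewrite eq_sym.
  by exists (val m x0); rewrite matchingK ltnW.
set c := val m b in rbc hle.
have mc : val m c = b by rewrite /c matchingK.
have cb : c != b by rewrite matching_neq.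
have := ug b c rbc hle m; rewrite (bigD1 c) //=.
have Ac : act (tperm c b) m = m.
  apply: matching_eqP => y; rewrite actE tpermV.
  case: (tpermP c b y) => [->|->|/eqP yc /eqP yb].
  - by rewrite -/c tpermL mc.
  - by rewrite mc tpermR.
  - rewrite tpermD //; first by rewrite eq_sym matching_sym mc eq_sym.
    by rewrite eq_sym matching_sym eq_sym.
rewrite Ac (bigID (fun a => r (val m a) == r c)) /=.
(* The swap turns the edges {b, c} and {a, m a} into {a, c} and {b, m a}. Here {a, m a} crosses rows
   while {a, c} does not, so fewer vertices lie on crossing edges. *)
rewrite [X in _ + (_ + (_ + X))]big1 ?addr0; last first.
  move=> a /andP[/andP[/eqP rac ac]] rma.
  have ab : a != b by apply: contra_neq rbc => <-.
  have mab : val m a != b by rewrite matching_sym -/c eq_sym.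
  have mac : val m a != c by rewrite matching_sym mc eq_sym.
  apply: IH; rewrite -ltnS (leq_trans _ hN) // ltnS; apply: proper_card; apply/properP; split; last first.
    exists c; rewrite !inE ?mc // negbK actE tpermV tpermD ?mc ?tpermR ?rac //; by rewrite eq_sym.
  apply/subsetP => y; rewrite !inE; rewrite actE tpermV.
  case: (tpermP a b y) => [->|->|/eqP ya /eqP yb].
  - by rewrite -/c tpermD ?rac ?eqxx // 1?eq_sym.
  - by move=> _; rewrite -/c eq_sym.
  have [->|yc] := altP (y =P c); first by rewrite mc tpermR rac eqxx.
  have [->|yma] := altP (y =P val m a); first by move=> _; rewrite matchingK rac eq_sym.
  rewrite tpermD //; first by rewrite eq_sym matching_sym eq_sym.
  by rewrite eq_sym matching_sym eq_sym.
(* When [m a] lies in the row of [c], the new matching is also the image of [m] under the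
   row-preserving swap of [c] and [m a]. *)
rewrite (eq_bigr (fun=> u m)); last first.
  move=> a /andP[/andP[/eqP rac ac]] /eqP rma.
  have ab : a != b by apply: contra_neq rbc => <-.
  have mab : val m a != b by rewrite matching_sym -/c eq_sym.
  have mac : val m a != c by rewrite matching_sym mc eq_sym.
  pose k := tperm c (val m a).
  have rk x : r (k x) = r x by rewrite /k; case: tpermP => // ->.
  rewrite -[RHS](ur k rk m); congr u; apply: matching_eqP => y.
  rewrite !actE !tpermV.
  have [->|ya] := altP (y =P a).
    rewrite tpermL -/c /k [tperm _ _ a]tpermD ?matching_neq // 1?eq_sym //.
    by rewrite tpermR tpermD // eq_sym.
  have [->|yb] := altP (y =P b).
    by rewrite tpermR /k [tperm _ _ b]tpermD // -/c tpermL tpermD // eq_sym ?matching_neq.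
  have [->|yc] := altP (y =P c).
    rewrite /k tpermL matchingK [tperm a b c]tpermD // 1?eq_sym // mc tpermR.
    by rewrite tpermD // ?matching_neq // eq_sym.
  have [->|yma] := altP (y =P val m a).
    rewrite /k tpermR mc [tperm a b (val m a)]tpermD // 1?eq_sym // ?matching_neq //.
    by rewrite matchingK tpermL tpermD.
  have mya : val m y != a by rewrite matching_sym eq_sym.
  have myb : val m y != b by rewrite matching_sym -/c eq_sym.
  have myc : val m y != c by rewrite matching_sym mc eq_sym.
  have myma : val m y != val m a by rewrite (inj_eq perm_inj).
  by rewrite /k ![tperm _ _ y]tpermD 1?eq_sym // !tpermD // 1?eq_sym.
rewrite sumr_const -!mulrS => /eqP.
by rewrite mulrn_eq0 /= => /eqP.
Qed.

Lemma row_move_to n (r : 'I_(n.*2) -> 'I_(n.*2)) b c i : r b != r c ->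
  #|row (move_to r b (r c)) i| =
    (if i == r c then #|row r i|.+1 else if i == r b then #|row r i|.-1 else #|row r i|)%N.
Proof.
move=> hbc; case: eqP => [->|/eqP ic].
  have -> : row (move_to r b (r c)) (r c) = b |: row r (r c).
    by apply/setP => x; rewrite !inE /move_to; case: (x =P b); rewrite ?eqxx.
  by rewrite cardsU1 inE hbc.
case: eqP => [->|/eqP ib].
  have -> : row (move_to r b (r c)) (r b) = row r (r b) :\ b.
    by apply/setP => x; rewrite !inE /move_to; case: (x =P b) => //=; rewrite eq_sym (negbTE hbc).
  by rewrite [in RHS](cardsD1 b) inE eqxx.
congr (#|pred_of_set _|); apply/setP => x; rewrite !inE /move_to.
by case: (x =P b) => // ->; rewrite eq_sym (negbTE ic) eq_sym (negbTE ib).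
Qed.

Lemma row_gt0 n (r : 'I_(n.*2) -> 'I_(n.*2)) b : (0 < #|row r (r b)|)%N.
Proof. by apply/card_gt0P; exists b; rewrite inE. Qed.

(** A numerical substitute for the order on shapes: it grows strictly when a vertex joins a row at
    least as large as its own, and it is bounded, so the distance to the bound drives the
    induction. *)
Definition row_energy n (r : 'I_(n.*2) -> 'I_(n.*2)) : nat := (\sum_i #|row r i| ^ 2)%N.

Lemma row_energy_bound n (r : 'I_(n.*2) -> 'I_(n.*2)) :
  (row_energy r <= n.*2 * n.*2 ^ 2)%N.
Proof.
rewrite /row_energy -[X in (_ <= X * _)%N](card_ord n.*2) -sum_nat_const.
apply: leq_sum => i _; rewrite leq_exp2r // -[X in (_ <= X)%N](card_ord n.*2).
exact: max_card.
Qed.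

Lemma row_energy_move_to n (r : 'I_(n.*2) -> 'I_(n.*2)) b c : r b != r c ->
  (#|row r (r b)| <= #|row r (r c)|)%N ->
  (row_energy r < row_energy (move_to r b (r c)))%N.
Proof.
move=> hbc hle; rewrite /row_energy (bigD1 (r b)) // [in X in (_ < X)%N](bigD1 (r b)) //=.
rewrite (bigD1 (r c)) 1?eq_sym //= [in X in (_ < X)%N](bigD1 (r c)) 1?eq_sym //=.
rewrite [X in (_ + (_ + X) < _)%N](eq_bigr (fun i => #|row (move_to r b (r c)) i| ^ 2))%N; last first.
  by move=> i /andP[ib ic]; rewrite row_move_to // (negbTE ic) (negbTE ib).
rewrite !addnA ltn_add2r !row_move_to // eqxx (negbTE hbc) eqxx.
move: (row_gt0 r b) hle; move: #|row r (r b)| #|row r (r c)| => [//|B] C _ hle.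
by rewrite -!mulnn /=; nia.
Qed.

(* Moving [b] to a row that is at least as large can only enlarge the large row, and it
   creates no new row. *)
Lemma wide_move_to n t (r : 'I_(n.*2) -> 'I_(n.*2)) b c : r b != r c ->
  (#|row r (r b)| <= #|row r (r c)|)%N -> wide t r -> wide t (move_to r b (r c)).
Proof.
move=> hbc hle /existsP[x /andP[h1 h2]].
have rows_le : (#|[set move_to r b (r c) y | y in setT]| <= #|[set r y | y in setT]|)%N.
  apply: subset_leq_card; apply/subsetP => _ /imsetP[y _ ->].
  by apply/imsetP; rewrite /move_to; case: ifP => _; [exists c | exists y].
(* If the large row itself loses [b], the receiving row was at least as large and now satisfies the
   strict inequality. *)
have [e|xb] := eqVneq (r x) (r b).
  apply/existsP; exists c.
  have -> : move_to r b (r c) c = r c by rewrite /move_to; case: ifP.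
  rewrite row_move_to // eqxx.
  rewrite e in h1.
  by apply/andP; split; first lia; apply/orP; left; lia.
apply/existsP; exists x.
have -> : move_to r b (r c) x = r x.
  by rewrite /move_to; case: eqP => // e; rewrite e eqxx in xb.
rewrite row_move_to //; case: ifP => _; last first.
  rewrite (negbTE xb) h1 /=; apply/orP.
  by case/orP: h2 => h; [left | right; exact: leq_trans rows_le h].
apply/andP; split; first exact: leqW.
by apply/orP; case/orP: h2 => h; [left; exact: leqW | right; exact: leq_trans rows_le h].
Qed.

Lemma kernel_act (R : comNzRingType) n (D : matching n -> matching n -> R)
    (g : matching n -> R) h m :
  (forall k m1 m2, D (act k m1) (act k m2) = D m1 m2) ->
  \sum_m' D m m' * g (act h m') = \sum_m' D (act h m) m' * g m'.
Proof.
move=> Dact; rewrite [RHS](reindex_inj (@act_inj n h)) /=.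
by apply: eq_bigr => m' _; rewrite Dact.
Qed.

Lemma row_invariant_kernel (R : comNzRingType) n (D : matching n -> matching n -> R) r
    (g : matching n -> R) :
  (forall k m1 m2, D (act k m1) (act k m2) = D m1 m2) ->
  row_invariant r g -> row_invariant r (fun m => \sum_m' D m m' * g m').
Proof.
move=> Dact gr h hh m; rewrite -kernel_act //.
by apply: eq_bigr => m' _; rewrite gr.
Qed.

Lemma row_invariant_indicator (R : nzRingType) n (r : 'I_(n.*2) -> 'I_(n.*2)) :
  row_invariant r (fun m => (refines r m)%:R : R).
Proof.
move=> h hh m; congr ((nat_of_bool _)%:R); apply/forallP/forallP => hm x.
  by have := hm (h x); rewrite actEg !hh.
by rewrite -[x](permKV h) actEg !hh.
Qed.

Lemma wide_kernel_eq0 (R : realFieldType) n t (D : matching n -> matching n -> R) :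
  (forall k m1 m2, D (act k m1) (act k m2) = D m1 m2) ->
  (forall m1 m2, D m1 m2 = D m2 m1) ->
  (forall r, wide t r -> (exists m, refines r m) ->
    \sum_(m1 | refines r m1) \sum_(m2 | refines r m2) D m1 m2 = 0) ->
  forall r, wide t r -> forall g : matching n -> R, row_invariant r g ->
  forall m, \sum_m' D m m' * g m' = 0.
Proof.
move=> Dact Dsym Dref r wr.
move: {2}(_ - _)%N (erefl (n.*2 * n.*2 ^ 2 - row_energy r)%N) => N.
elim/ltn_ind: N r wr => N IH r wr eN.
(* By equivariance the Garnir sum of [D g] is [D] applied to the function of [move_to_invariant],
   which the induction hypothesis for the moved labelling kills. *)
have gar g : row_invariant r g -> garnir r (fun m => \sum_m' D m m' * g m').
  move=> gr b c hbc hle m.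
  have hlt := row_energy_move_to hbc hle.
  have := row_energy_bound (move_to r b (r c)) => hb.
  have lt' : ((n.*2 * n.*2 ^ 2 - row_energy (move_to r b (r c))) < N)%N by lia.
  have := IH _ lt' _ (wide_move_to hbc hle wr) erefl _ (move_to_invariant hbc gr) m.
  move=> h; rewrite -[RHS]h.
  under [RHS]eq_bigr do rewrite mulrDr mulr_sumr.
  rewrite big_split /=; congr (_ + _); rewrite [RHS]exchange_big /=.
  by apply: eq_bigr => a _; exact/esym/kernel_act.
(* The image of the indicator is constant on the matchings refining [r], so its vanishing pairing
   with the indicator forces that constant to be 0. *)
have f0 : forall m, \sum_m' D m m' * (refines r m')%:R = 0.
  apply: (@garnir_eq0 _ _ r (fun m => \sum_m' D m m' * (refines r m')%:R)).
  - exact: (row_invariant_kernel Dact (@row_invariant_indicator R n r)).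
  - exact: (gar _ (@row_invariant_indicator R n r)).
  move=> m rm.
  have := Dref r wr (ex_intro _ m rm).
  rewrite (eq_bigr (fun=> \sum_m' D m m' * (refines r m')%:R)); last first.
    move=> m1 rm1.
    rewrite -(row_invariant_refines (row_invariant_kernel Dact (@row_invariant_indicator R n r)) rm1 rm) /=.
    rewrite [RHS](bigID (refines r)) /= [X in _ + X]big1 ?addr0; last first.
      by move=> m2 /negbTE ->; rewrite mulr0.
    by apply: eq_bigr => m2 ->; rewrite mulr1.
  rewrite sumr_const => /eqP; rewrite mulrn_eq0 => /orP[|/eqP //].
  by rewrite eqn0Ngt => /negP []; apply/card_gt0P; exists m.
move=> g gr; apply: (@garnir_eq0 _ _ r (fun m => \sum_m' D m m' * g m')).
- exact: (row_invariant_kernel Dact gr).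
- exact: (gar _ gr).
move=> m rm.
have := row_invariant_refines (row_invariant_kernel Dact gr) rm => cst.
(* Symmetry moves [D] from [g] onto the indicator, where [f0] applies. *)
have : \sum_m1 (refines r m1)%:R * \sum_m' D m1 m' * g m' = 0.
  under eq_bigr do rewrite mulr_sumr.
  rewrite exchange_big /= big1 // => m2 _.
  transitivity (g m2 * \sum_m' D m2 m' * (refines r m')%:R); last by rewrite f0 mulr0.
  by rewrite mulr_sumr; apply: eq_bigr => m1 _; rewrite (Dsym m1); ring.
rewrite (bigID (refines r)) /= [X in _ + X]big1 ?addr0; last first.
  by move=> m2 /negbTE ->; rewrite mul0r.
rewrite (eq_bigr (fun=> \sum_m' D m m' * g m')); last first.
  by move=> m1 rm1; rewrite rm1 mul1r (cst m1 rm1).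
rewrite sumr_const => /eqP; rewrite mulrn_eq0 => /orP[|/eqP //].
by rewrite eqn0Ngt => /negP []; apply/card_gt0P; exists m.
Qed.

(** * Fat partitions and row labels *)

Lemma card_ord_lt n k : (k <= n)%N -> #|[set i : 'I_n | (i < k)%N]| = k.
Proof.
move=> kn; rewrite -sum1_card.
under eq_bigl do rewrite inE.
by rewrite -(big_ord_widen _ (fun=> 1%N)) // sum_nat_const card_ord muln1.
Qed.

Lemma pv_anti n (l : part n) (i j : 'I_n) : (i <= j)%N -> (pv l j <= pv l i)%N.
Proof.
case/andP: (valP l) => /forallP h _ ij.
exact: (implyP (forallP (h i) j)).
Qed.

Lemma pv_sum n (l : part n) : (\sum_(i < n) pv l i)%N = n.
Proof. by case/andP: (valP l) => _ /eqP. Qed.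

Lemma hookp_sum n t : (t < n)%N -> (\sum_(i < n) hookp t i)%N = n.
Proof.
case: n => // n tn; rewrite big_ord_recl /hookp /=.
rewrite (eq_bigr (fun i : 'I_n => ((i < t)%N : nat))); last first.
  by move=> i _; rewrite /bump /= add1n; case: ifP.
rewrite -[X in (_ + X)%N]big_mkcond /= sum1_card -[X in (_ + X)%N](cardsE).
rewrite card_ord_lt // subnK // ltnW //.
Qed.

Lemma ltn_sum_ord n (f g : 'I_n -> nat) i :
  (forall j, f j <= g j)%N -> (f i < g i)%N -> (\sum_j f j < \sum_j g j)%N.
Proof.
move=> h hi; rewrite (bigD1 i) // [in X in (_ < X)%N](bigD1 i) //= -addSn.
by apply: leq_add => //; apply: leq_sum.
Qed.

(** [i0] stands for the index 0, which ['I_n] contains only when n is positive. *)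
Definition fat_parts n t (l : part n) (i0 : 'I_n) :=
  (n - t <= pv l i0)%N /\
  ((n - t < pv l i0)%N \/ forall i : 'I_n, (t <= i)%N -> pv l i = 0%N).

(** Suppose the first part is n - t and some part of index at least t is positive. Then the
    partition is entrywise at least the hook and exceeds it at index [i], although both sum to n. *)
Lemma fatp_parts n t (l : part n) (i0 : 'I_n) : (t < n)%N -> i0 = 0%N :> nat ->
  fatp t l -> fat_parts t l i0.
Proof.
move=> tn i00 /existsP[i /andP[hi /forallP hlt]].
have hook0 : hookp t i0 = (n - t)%N by rewrite /hookp i00.
have [ii0|ii0] := eqVneq i i0.
  by rewrite ii0 hook0 in hi; split; [exact: ltnW | left].
have ipos : (0 < i)%N by rewrite lt0n; apply: contra ii0 => /eqP e; apply/eqP/val_inj; rewrite /= e.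
have e0 : pv l i0 = (n - t)%N.
  by rewrite -hook0; apply/esym/eqP; apply: (implyP (hlt i0)); rewrite i00.
split; first by rewrite e0.
right => k tk; apply/eqP; rewrite -leqn0 leqNgt; apply/negP => kpos.
suff : (\sum_(j < n) hookp t j < \sum_(j < n) pv l j)%N.
  by rewrite hookp_sum // pv_sum ltnn.
apply: (@ltn_sum_ord _ _ _ i) => // j.
case: (ltngtP j i) => [ji|ij|/val_inj -> ].
- by rewrite (eqP (implyP (hlt j) ji)).
- rewrite /hookp; case: ifP => [/eqP j0|_]; first by rewrite j0 in ij.
  case: (leqP j t) => // jt.
  by apply: leq_trans kpos _; apply: pv_anti; apply: leq_trans jt tk.
- exact: ltnW.
Qed.

(** If the first part equals n - t, the second must exceed 1: otherwise all later parts are at most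
    1 and the one of index t is 0, so the sum falls below that of the hook. *)
Lemma parts_fatp n t (l : part n) (i0 : 'I_n) : (t.*2 < n)%N -> i0 = 0%N :> nat ->
  fat_parts t l i0 -> fatp t l.
Proof.
move=> t2n i00 [h1 h2].
have hook0 : hookp t i0 = (n - t)%N by rewrite /hookp i00.
have [h|h] := ltnP (n - t) (pv l i0).
  apply/existsP; exists i0; rewrite hook0 h /=; apply/forallP => j.
  by rewrite i00.
have e0 : pv l i0 = (n - t)%N by apply/eqP; rewrite eqn_leq h h1.
have {}h2 : forall i : 'I_n, (t <= i)%N -> pv l i = 0%N by case: h2 => //; rewrite e0 ltnn.
have tn : (t < n)%N by lia.
have tpos : (0 < t)%N.
  by rewrite lt0n; apply/eqP => t0; have := h2 i0; rewrite t0 e0 t0 subn0 i00 => /(_ isT) e; lia.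
have n1 : (1 < n)%N by lia.
pose i1 := Ordinal n1.
apply/existsP; exists i1; apply/andP; split; last first.
  apply/forallP => j; apply/implyP => /= j1.
  have -> : j = i0 by apply: val_inj => /=; lia.
  by rewrite e0 hook0.
rewrite /hookp /= tpos ltnNge; apply/negP => l1.
suff : (\sum_(j < n) pv l j < \sum_(j < n) hookp t j)%N.
  by rewrite hookp_sum // pv_sum ltnn.
apply: (@ltn_sum_ord _ _ _ (Ordinal tn)) => [j|]; last first.
  by rewrite h2 // /hookp /= (gtn_eqF tpos) leqnn.
rewrite /hookp; case: ifP => [/eqP j0|/eqP j0].
  by have -> : j = i0; [apply: val_inj; rewrite /= j0 i00 | rewrite e0].
have [tj|jt] := leqP t j; first by rewrite h2.
rewrite (ltnW jt); apply: leq_trans l1; apply: pv_anti => /=; lia.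
Qed.

Lemma psum_mono n (l : part n) r s : (r <= s)%N -> (psum l r <= psum l s)%N.
Proof.
move=> rs; rewrite /psum big_mkcond [in X in (_ <= X)%N]big_mkcond /=.
apply: leq_sum => i _; case: ifP => // ir; by rewrite (leq_trans ir rs).
Qed.

Lemma psum1 n (l : part n) (i0 : 'I_n) : i0 = 0%N :> nat -> psum l 1 = (pv l i0).*2.
Proof.
move=> i00; rewrite /psum (big_pred1 i0) // => i /=.
by rewrite ltnS leqn0 -val_eqE /= i00.
Qed.

Lemma psum_ge n (l : part n) (i0 i1 : 'I_n) r : i0 = 0%N :> nat -> i1 = 1%N :> nat ->
  (1 < r)%N -> ((pv l i0).*2 + (pv l i1).*2 <= psum l r)%N.
Proof.
move=> i00 i11 r1; rewrite /psum (bigD1 i0) ?i00 ?(ltnW r1) //= (bigD1 i1) /=; last first.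
  by rewrite i11 r1 -val_eqE /= i00 i11.
by rewrite addnA leq_addr.
Qed.

Lemma psum_total n t (l : part n) r : (forall i : 'I_n, (t <= i)%N -> pv l i = 0%N) ->
  (t <= r)%N -> psum l r = n.*2.
Proof.
move=> h tr; rewrite -[in RHS](pv_sum l) -[RHS]muln2 big_distrl /= /psum big_mkcond /=.
apply: eq_bigr => i _; rewrite muln2; case: ltnP => // ri.
by rewrite h // (leq_trans tr).
Qed.

Lemma rowof_ltn n (l : part n) (k : 'I_(n.*2)) : (rowof l k < n.*2)%N.
Proof.
have : (rowof l k <= n)%N by rewrite -[X in (_ <= X)%N](card_ord n) max_card.
by have := ltn_ord k; lia.
Qed.

Definition row_label n (l : part n) (k : 'I_(n.*2)) : 'I_(n.*2) := Ordinal (rowof_ltn l k).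

Lemma rowof_eq0 n (l : part n) (i0 : 'I_n) (k : 'I_(n.*2)) : i0 = 0%N :> nat ->
  (rowof l k == 0%N) = (k < (pv l i0).*2)%N.
Proof.
move=> i00; rewrite /rowof cards_eq0 ltnNge -(psum1 l i00).
apply/eqP/negP => [h hk|h].
  by have := in_set0 i0; rewrite -h inE i00 hk.
apply/setP => i; rewrite !inE; apply/negP => hk; apply: h.
by apply: leq_trans hk; apply: psum_mono.
Qed.

(** Row 0 of the tableau is the large row. If the first part is exactly n - t, the first t rows
    already fill the tableau, so at most t labels occur. *)
Lemma wide_row_label n t (l : part n) : (t.*2 < n)%N -> fatp t l -> wide t (row_label l).
Proof.
move=> t2n hf; have n0 : (0 < n)%N by lia.
pose i0 := Ordinal n0.
have tn : (t < n)%N by lia.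
have [h1 h2] := fatp_parts tn (erefl : i0 = 0%N :> nat) hf.
have l0n : (pv l i0 <= n)%N by rewrite -[X in (_ <= X)%N](pv_sum l) (bigD1 i0) //= leq_addr.
have k0h : (0 < n.*2)%N by lia.
pose k0 : 'I_(n.*2) := Ordinal k0h.
have rk0 : rowof l k0 == 0%N by rewrite (@rowof_eq0 _ _ i0) //=; lia.
have c0 : #|row (row_label l) (row_label l k0)| = (pv l i0).*2.
  rewrite -[RHS](@card_ord_lt n.*2) ?leq_double //.
  congr (#|pred_of_set _|); apply/setP => k; rewrite !inE -val_eqE /= (eqP rk0).
  exact: rowof_eq0.
apply/existsP; exists k0; rewrite c0 leq_double h1 ltn_double /=.
case: h2 => [->//|h2]; apply/orP; right.
have tpos : (0 < t)%N.
  by rewrite lt0n; apply/eqP => t0; have := h2 i0; rewrite t0 => /(_ isT) e; lia.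
rewrite -[X in (_ <= X)%N](@card_ord_lt n.*2); last by lia.
apply: subset_leq_card; apply/subsetP => _ /imsetP[k _ ->]; rewrite inE /=.
rewrite -(prednK tpos) ltnS /rowof -[X in (_ <= X)%N](@card_ord_lt n); last by lia.
apply: subset_leq_card; apply/subsetP => i; rewrite !inE leqNgt => hk.
rewrite ltnNge; apply: contra hk => hi.
by rewrite (psum_total h2) // -(prednK tpos) ltnS.
Qed.

Lemma not_is_row_lt n (l : part n) (i0 : 'I_n) : i0 = 0%N :> nat -> ~~ is_row l ->
  (pv l i0 < n)%N.
Proof.
move=> i00 hl; rewrite ltn_neqAle; apply/andP; split; last first.
  by rewrite -[X in (_ <= X)%N](pv_sum l) (bigD1 i0) //= leq_addr.
apply: contra hl => /eqP e; apply/forallP => i.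
case: ifP => [/eqP ii0|ii0]; first by have -> : i = i0; [apply: val_inj; rewrite /= ii0 i00 | rewrite e].
have := pv_sum l; rewrite (bigD1 i0) //= (bigD1 i) /=; last first.
  by rewrite -val_eqE /= i00 ii0.
by move: e; clear; lia.
Qed.

(** The witnesses are the first boxes of the first two rows, both in column 0. Their swap is an odd
    element of the column stabiliser. *)
Lemma colof_transposition n (l : part n) : ~~ is_row l ->
  exists k k' : 'I_(n.*2), k != k' /\ colof l k = colof l k'.
Proof.
move=> hl.
have n0 : (0 < n)%N.
  by case: n l hl => // l /negP []; apply/forallP; case.
pose i0 := Ordinal n0.
have l0n := not_is_row_lt (erefl : i0 = 0%N :> nat) hl.
have k0h : (0 < n.*2)%N by lia.
have k1h : ((pv l i0).*2 < n.*2)%N by rewrite ltn_double.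
have [i hi] : exists i, (i != i0) && (0 < pv l i)%N.
  apply/existsP; case: (boolP [exists i, _]) => // /existsPn h.
  have := pv_sum l; rewrite (bigD1 i0) //= big1 ?addn0; first by lia.
  by move=> i ii0; have := h i; rewrite ii0 /= lt0n negbK => /eqP.
case/andP: hi => ii0 li.
have ipos : (0 < i)%N by rewrite lt0n; apply: contra ii0 => /eqP e; apply/eqP/val_inj; rewrite /= e.
have n1 : (1 < n)%N by apply: leq_ltn_trans ipos (ltn_ord i).
pose i1 := Ordinal n1.
have l1 : (0 < pv l i1)%N by apply: leq_trans li _; apply: pv_anti.
exists (Ordinal k0h), (Ordinal k1h); split.
  rewrite -val_eqE /= eq_sym -lt0n double_gt0; apply: leq_trans l1 _; exact: pv_anti.
rewrite /colof /= sub0n.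
have -> : rowof l (Ordinal k1h) = 1%N; last by rewrite (@psum1 _ _ i0) // subnn.
rewrite /rowof (_ : [set i2 | _] = [set i0]) ?cards1 //; apply/setP => j; rewrite !inE.
apply/idP/eqP => [|->]; last by rewrite (@psum1 _ _ i0).
move=> h; apply: val_inj => /=; apply/eqP; rewrite -leqn0 leqNgt; apply/negP => jpos.
have := leq_trans (@psum_ge n l i0 i1 j.+1 erefl erefl jpos) h => /=.
by lia.
Qed.

(** * The defect kernel on the isotypic components *)

Definition defect (R : realType) n t (x : part n -> R) (m m' : matching n) : R :=
  \sum_(r | fatp t r) x r * Aassoc R r m m'
    - zeta R n t * (m == m')%:R - (1 - zeta R n t) / #|[set: matching n]|%:R.

Lemma defect_act (R : realType) n t (x : part n -> R) g (m m' : matching n) :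
  defect t x (act g m) (act g m') = defect t x m m'.
Proof.
rewrite /defect (inj_eq (@act_inj n g)).
by under eq_bigr do rewrite /Aassoc cycle_type_act.
Qed.

Lemma defect_sym (R : realType) n t (x : part n -> R) (m m' : matching n) :
  defect t x m m' = defect t x m' m.
Proof.
rewrite /defect eq_sym.
by under eq_bigr do rewrite /Aassoc cycle_typeC.
Qed.

Lemma defect_sum (R : realType) n t (x : part n -> R) (v : matching n -> R) m :
  \sum_m' defect t x m m' * v m' =
  Atilde t x v m - zeta R n t * v m
    - (1 - zeta R n t) / #|[set: matching n]|%:R * \sum_m' v m'.
Proof.
under eq_bigr do rewrite /defect 2!mulrBl.
rewrite !sumrB; congr (_ - _ - _); last by rewrite mulr_sumr.
  under eq_bigr do rewrite mulr_suml.
  rewrite exchange_big; apply: eq_bigr => r _; rewrite mulr_sumr.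
  by apply: eq_bigr => m' _; rewrite mulrA.
rewrite (bigD1 m) //= eqxx mulr1 big1 ?addr0 // => m' hm.
by rewrite eq_sym (negbTE hm) mulr0 mul0r.
Qed.

(** The sum over the row stabiliser is the outer one, so a row-preserving [h] is absorbed by
    reindexing it. *)
Lemma ysym_row_invariant (R : realType) n (l : part n) (w : matching n -> R) :
  row_invariant (row_label l) (ysym l w).
Proof.
move=> h hh m; rewrite /ysym [RHS](reindex_inj (mulIg h^-1%g)) /=.
have hr k : rowof l (h k) = rowof l k by have /(congr1 val) := hh k.
have hrV k : rowof l (h^-1%g k) = rowof l k by rewrite -{2}(permKV h k) hr.
apply: eq_big => [p|p _].
  apply/forallP/forallP => hp k; first by rewrite permM hrV.
  by have := hp k; rewrite permM hrV.
by apply: eq_bigr => q _; rewrite /rep invMg invgK actM.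
Qed.

Lemma rep_sum (R : realType) n g (v : matching n -> R) :
  \sum_m rep g v m = \sum_m v m.
Proof. by rewrite [RHS](reindex_inj (@act_inj n g^-1%g)). Qed.

(** Multiplication by a transposition inside a column permutes the summands and changes every
    sign. *)
Lemma signed_colstab_sum (R : realType) n (l : part n) : ~~ is_row l ->
  \sum_(q : {perm 'I_(n.*2)} | colstab l q) (-1) ^+ (odd_perm q) = 0 :> R.
Proof.
move=> /colof_transposition[k [k' [kk' ck]]].
set s : R := \sum_(q | _) _.
suff : s = - s by move/esym/eqP; rewrite eqNr => /eqP.
rewrite {1}/s (reindex_inj (mulgI (tperm k k'))) /= -sumrN.
have ct y : colof l (tperm k k' y) = colof l y by case: tpermP => // ->.
apply: eq_big => [q|q _]; last by rewrite odd_permM odd_tperm kk' signr_addb expr1 mulN1r.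
apply/forallP/forallP => hq y.
  by have := hq (tperm k k' y); rewrite permM tpermK ct.
by rewrite permM (eqP (hq _)) ct.
Qed.

(** Translation preserves the total of a function, so each row permutation contributes the total of
    [w] times the signed sum over the column stabiliser. *)
Lemma ysym_sum (R : realType) n (l : part n) (w : matching n -> R) : ~~ is_row l ->
  \sum_m ysym l w m = 0.
Proof.
move=> hl; rewrite /ysym exchange_big big1 // => p _.
rewrite exchange_big /=.
under eq_bigr do rewrite -mulr_sumr !rep_sum.
by rewrite -mulr_suml signed_colstab_sum // mul0r.
Qed.

(** Every matching refines a labelling with a single row, so row invariance means constancy. For n =
    0 there is only one matching. *)
Lemma ysym_row_const (R : realType) n (l : part n) (w : matching n -> R) m m' : is_row l ->
  ysym l w m = ysym l w m'.
Proof.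
move=> hl; case: n l w m m' hl => [|n] l w m m' hl.
  by congr (ysym _ _ _); apply: matching_eqP; case.
have l0 : pv l ord0 = n.+1 by have := forallP hl ord0; rewrite eqxx => /eqP.
have lab k k' : row_label l k = row_label l k'.
  apply: val_inj => /=; transitivity 0%N.
    by apply/eqP; rewrite (@rowof_eq0 _ _ ord0) // l0.
  by apply/esym/eqP; rewrite (@rowof_eq0 _ _ ord0) // l0.
have all_ref m1 : refines (row_label l) m1 by apply/forallP => k; apply/eqP.
exact: (row_invariant_refines (@ysym_row_invariant _ _ l w) (all_ref m) (all_ref m')).
Qed.

Lemma rep_kernel_eq0 (R : realType) n (D : matching n -> matching n -> R) g v :
  (forall k m1 m2, D (act k m1) (act k m2) = D m1 m2) ->
  (forall m, \sum_m' D m m' * v m' = 0) ->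
  forall m, \sum_m' D m m' * rep g v m' = 0.
Proof. by move=> Dact h m; rewrite /rep kernel_act. Qed.

(** Once the defect kills [v], [Atilde] sends [v] to zeta times [v] plus 1 - zeta times the mean of
    [v]. The mean is [v] itself for the one-row shape and 0 for the others. *)
Lemma Atilde_eigen (R : realType) n t (x : part n -> R) : (t.*2 < n)%N ->
  (forall r, wide t r -> (exists m, refines r m) ->
    \sum_(m1 | refines r m1) \sum_(m2 | refines r m2) defect t x m1 m2 = 0) ->
  forall l : part n, fatp t l -> forall v : matching n -> R, inS l v ->
  forall m : matching n, Atilde t x v m = eta_target R t l * v m.
Proof.
move=> t2n hD l hl v [f hv] m.
have Dy w m1 : \sum_m' defect t x m1 m' * ysym l w m' = 0.
  exact: (wide_kernel_eq0 (defect_act t x) (defect_sym t x) hD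
           (wide_row_label t2n hl) (@ysym_row_invariant _ _ l w)).
have Dv : \sum_m' defect t x m m' * v m' = 0.
  under eq_bigr do rewrite hv mulr_sumr.
  rewrite exchange_big big1 // => g _.
  exact: (rep_kernel_eq0 g (defect_act t x) (Dy (f g))).
move: Dv; rewrite defect_sum /eta_target; case: ifP => hrow; last first.
  have -> : \sum_m' v m' = 0.
    under eq_bigr do rewrite hv.
    rewrite exchange_big big1 // => g _; rewrite rep_sum ysym_sum //; exact/negbT.
  by rewrite mulr0 subr0 => /eqP; rewrite subr_eq0 => /eqP.
have -> : \sum_m' v m' = #|[set: matching n]|%:R * v m.
  rewrite (eq_bigr (fun=> v m)); first by rewrite sumr_const cardsT mulr_natl.
  move=> m' _; rewrite !hv; apply: eq_bigr => g _; exact: ysym_row_const.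
rewrite mulrA divfK; first by move=> h; apply/eqP; rewrite -subr_eq0; apply/eqP; rewrite -h; ring.
by rewrite pnatr_eq0 cards_eq0; apply/set0Pn; exists m.
Qed.

(** * Counting matchings along walks *)

Lemma card_fibers (T U : finType) (S : {set T}) (f : T -> U) :
  #|S| = (\sum_(y in f @: S) #|[set s in S | f s == y]|)%N.
Proof.
rewrite -sum1_card (partition_big f [in f @: S]) /=; last by move=> s; apply: imset_f.
apply: eq_bigr => y _; rewrite -sum1_card; apply: eq_bigl => s; by rewrite inE.
Qed.

Lemma card_le_fibers (T U : finType) (S : {set T}) (f : T -> U) d c :
  (#|f @: S| <= d)%N -> (forall s, s \in S -> #|[set s' in S | f s' == f s]| <= c)%N ->
  (#|S| <= d * c)%N.
Proof.
move=> hd hc; rewrite (card_fibers S f); apply: leq_trans (leq_mul hd (leqnn c)).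
rewrite -sum_nat_const; apply: leq_sum => _ /imsetP[s hs ->]; exact: hc.
Qed.

Lemma card_ge_fibers (T U : finType) (S : {set T}) (f : T -> U) d c :
  (d <= #|f @: S|)%N -> (forall s, s \in S -> c <= #|[set s' in S | f s' == f s]|)%N ->
  (d * c <= #|S|)%N.
Proof.
move=> hd hc; rewrite (card_fibers S f); apply: leq_trans (leq_mul hd (leqnn c)) _.
rewrite -sum_nat_const; apply: leq_sum => _ /imsetP[s hs ->]; exact: hc.
Qed.

(** The node of [s] at depth [i] in the tree obtained by revealing [w 0], [w 1], ... in turn. *)
Definition agree (T U : finType) (S : {set T}) (w : nat -> T -> U) i s : {set T} :=
  [set s' in S | [forall j : 'I_i.+1, w j s' == w j s]].

Lemma agreeP (T U : finType) (S : {set T}) (w : nat -> T -> U) i s s' :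
  reflect (s' \in S /\ forall j, (j <= i)%N -> w j s' = w j s) (s' \in agree S w i s).
Proof.
rewrite inE; apply: (iffP andP) => -[h1 h2]; split => //.
  by move=> j ji; apply/eqP; apply: (forallP h2 (Ordinal (ji : (j < i.+1)%N))).
by apply/forallP => j; apply/eqP/h2; rewrite -ltnS.
Qed.

Lemma agreeS (T U : finType) (S : {set T}) (w : nat -> T -> U) i s s' :
  s' \in agree S w i s ->
  [set s2 in agree S w i s | w i.+1 s2 == w i.+1 s'] = agree S w i.+1 s'.
Proof.
case/agreeP => _ h'; apply/setP => s2; rewrite inE.
apply/andP/agreeP => [[/agreeP[hS h] /eqP e]|[hS h]].
  split=> // j; rewrite leq_eqVlt => /orP[/eqP ->//|ji].
  by rewrite h // h'.
split; last by rewrite h.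
by apply/agreeP; split=> // j ji; rewrite h ?h' // ltnW.
Qed.

Lemma agree_refl (T U : finType) (S : {set T}) (w : nat -> T -> U) i s :
  s \in S -> s \in agree S w i s.
Proof. by move=> hs; apply/agreeP. Qed.

Lemma agree0 (T U : finType) (S : {set T}) (w : nat -> T -> U) s :
  (forall s1 s2, w 0%N s1 = w 0%N s2) -> agree S w 0 s = S.
Proof.
move=> w0; apply/setP => s'; apply/agreeP/idP => [[]//|hS]; split=> // j.
by rewrite leqn0 => /eqP ->.
Qed.

(** A node at depth [i] has at most [d i] children and a node at depth [K] at most [c] elements. The
    root is all of [S] because [w 0] is constant. *)
Lemma card_le_chain (T U : finType) (S : {set T}) (w : nat -> T -> U) (d : nat -> nat) c K :
  (forall s1 s2, w 0%N s1 = w 0%N s2) ->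
  (forall i s, (i < K)%N -> s \in S -> #|w i.+1 @: agree S w i s| <= d i)%N ->
  (forall s, s \in S -> #|agree S w K s| <= c)%N ->
  (#|S| <= (\prod_(i < K) d i) * c)%N.
Proof.
move=> w0 hd hc.
have [->|/set0Pn[s0 hs0]] := eqVneq S set0; first by rewrite cards0.
rewrite -(agree0 S s0 w0) -(big_mkord xpredT).
suff H : forall j i s, (i + j = K)%N -> s \in S ->
    (#|agree S w i s| <= (\prod_(i <= k < K) d k) * c)%N by apply: (H K).
elim=> [|j IH] i s.
  by rewrite addn0 => -> hs; rewrite big_geq // mul1n hc.
move=> e hs; have iK : (i < K)%N by lia.
rewrite big_ltn // -mulnA; apply: (@card_le_fibers _ _ _ (w i.+1)); first exact: hd.
move=> s' hs'; rewrite agreeS //; apply: IH; first by lia.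
by case/agreeP: hs'.
Qed.

Lemma card_ge_chain (T U : finType) (S : {set T}) (w : nat -> T -> U) (d : nat -> nat) K s0 :
  (forall s1 s2, w 0%N s1 = w 0%N s2) -> s0 \in S ->
  (forall i s, (i < K)%N -> s \in S -> d i <= #|w i.+1 @: agree S w i s|)%N ->
  (\prod_(i < K) d i <= #|S|)%N.
Proof.
move=> w0 hs0 hd.
rewrite -(agree0 S s0 w0) -(big_mkord xpredT).
suff H : forall j i s, (i + j = K)%N -> s \in S ->
    (\prod_(i <= k < K) d k <= #|agree S w i s|)%N by apply: (H K).
elim=> [|j IH] i s.
  rewrite addn0 => -> hs; rewrite big_geq // card_gt0; apply/set0Pn; exists s.
  exact: agree_refl.
move=> e hs; have iK : (i < K)%N by lia.
rewrite big_ltn //; apply: (@card_ge_fibers _ _ _ (w i.+1)); first exact: hd.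
move=> s' hs'; rewrite agreeS //; apply: IH; first by lia.
by case/agreeP: hs'.
Qed.

Lemma dfact2S k : dfact2 k.+1 = (k.+1.*2 * dfact2 k)%N.
Proof. by rewrite /dfact2 expnS factS -muln2; ring. Qed.

Lemma dfact2_gt0 k : (0 < dfact2 k)%N.
Proof. by rewrite /dfact2 muln_gt0 expn_gt0 fact_gt0. Qed.

Lemma dfact2_prod k j : (j <= k)%N ->
  (\prod_(i < j) (k.*2 - i.*2) * dfact2 (k - j) = dfact2 k)%N.
Proof.
elim: j => [|j IH] jk; first by rewrite big_ord0 mul1n subn0.
rewrite big_ord_recr /= -mulnA -[in RHS](IH (ltnW jk)); congr (_ * _)%N.
have -> : (k - j = (k - j.+1).+1)%N by lia.
by rewrite dfact2S; congr (_ * _)%N; lia.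
Qed.

(** The walk meets every second vertex of the alternating cycle through [v]. The matching [m'] comes
    last so that [walk m v] is a family of functions of [m'], as the chain lemmas require. *)
Definition walk n (m : matching n) (v : 'I_(n.*2)) (i : nat) (m' : matching n) : 'I_(n.*2) :=
  iter i (fun x => val m (val m' x)) v.

Lemma walkD n (m m' : matching n) v i j :
  walk m v (i + j) m' = walk m (walk m v j m') i m'.
Proof. by rewrite /walk iterD. Qed.

Lemma walkS n (m m' : matching n) v i :
  walk m v i.+1 m' = val m (val m' (walk m v i m')).
Proof. by []. Qed.

(** If the walk from [v] were at [m v] after i + 2 steps, then the walk from [m (m' v)] would be at
    the [m]-partner of its own start after i steps. *)
Lemma walk_neq_edge n (m m' : matching n) v i : walk m v i m' != val m v.
Proof.
elim/ltn_ind: i v => -[|[|i]] IH v.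
- by rewrite /walk /= eq_sym matching_neq.
- by rewrite /walk /= (inj_eq perm_inj) matching_neq.
have := IH i (ltnW (ltnSn _)) (val m (val m' v)); apply: contra => /eqP.
rewrite walkS -addn1 walkD => /(@perm_inj _ (val m)) /(congr1 (val m')).
by rewrite matchingK /walk /= => ->; rewrite matchingK.
Qed.

Lemma walk_neq n (m m' : matching n) v i j : walk m v i m' != val m (walk m v j m').
Proof.
case: (leqP i j) => ij.
  by rewrite -(subnK ij) walkD eq_sym matching_sym eq_sym walk_neq_edge.
by rewrite -(subnK (ltnW ij)) walkD walk_neq_edge.
Qed.

Definition component n (m m' : matching n) v : {set 'I_(n.*2)} :=
  [set y | connect (union_rel m m') v y].

(** The walk records one endpoint of each edge of [m] that it meets; here both endpoints are
    kept. *)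
Definition visited n (m m' : matching n) v i : {set 'I_(n.*2)} :=
  [set walk m v (j : 'I_i) m' | j in setT] :|: [set val m (walk m v (j : 'I_i) m') | j in setT].

Lemma visitedP n (m m' : matching n) v i x :
  reflect (exists2 j, (j < i)%N & x = walk m v j m' \/ x = val m (walk m v j m'))
    (x \in visited m m' v i).
Proof.
apply: (iffP setUP) => [[] /imsetP[j _ ->]|[j ji [->|->]]].
- by exists j => //; left.
- by exists j => //; right.
- by left; apply/imsetP; exists (Ordinal ji).
- by right; apply/imsetP; exists (Ordinal ji).
Qed.

Lemma card_visited_le n (m m' : matching n) v i : (#|visited m m' v i| <= i.*2)%N.
Proof.
apply: leq_trans (leq_card_setU _ _) _; rewrite -[X in (_ <= X)%N]addnn; apply: leq_add;
  by apply: leq_trans (leq_imset_card _ _) _; rewrite cardsT card_ord.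
Qed.

Definition walk_inj_lt n (m m' : matching n) v K :=
  forall i j, (i < j)%N -> (j < K)%N -> walk m v i m' != walk m v j m'.

Lemma card_visited n (m m' : matching n) v i : walk_inj_lt m m' v i ->
  #|visited m m' v i| = i.*2.
Proof.
move=> hinj.
have inj : injective (fun j : 'I_i => walk m v j m').
  move=> j k e; apply: val_inj; case: (ltngtP j k) => // jk.
    by have := hinj _ _ jk (ltn_ord k); rewrite e eqxx.
  by have := hinj _ _ jk (ltn_ord j); rewrite e eqxx.
rewrite /visited cardsU.
have -> : [set walk m v (j : 'I_i) m' | j in setT] :&:
          [set val m (walk m v (j : 'I_i) m') | j in setT] = set0.
  apply/setP => x; rewrite !inE; apply/negP => /andP[/imsetP[j _ ->] /imsetP[k _ /eqP]].
  by rewrite (negbTE (walk_neq _ _ _ _ _)).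
rewrite cards0 subn0 !card_imset ?cardsT ?card_ord ?addnn //.
by move=> j k /perm_inj; apply: inj.
Qed.

(* The walk closes up after the first return, so a large component forces a long injective walk. *)
Lemma walk_inj_component n (m m' : matching n) v K :
  (K.*2 <= #|component m m' v|)%N -> walk_inj_lt m m' v K.
Proof.
move=> hK i j ij jK; apply/negP => /eqP e.
have [p p0 [pK e']] : exists2 p, (0 < p)%N & (p < K)%N /\ walk m v p m' = v.
  exists (j - i)%N; [by lia | split; first by lia].
  elim: i j ij jK e => [|i IH] [|j] // ij jK e.
  rewrite subSS; apply: IH => //; first exact: ltnW.
  by move: e; rewrite !walkS => /perm_inj /perm_inj.
(* After a return at time [p], the vertices visited so far are closed under both matchings, which
   leaves at most 2p of them for the component. *)
suff sub : component m m' v \subset visited m m' v p.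
  have := subset_leq_card sub; have := card_visited_le m m' v p; lia.
apply/subsetP => y; rewrite inE => /connectP[q hq ->].
have: v \in visited m m' v p by apply/visitedP; exists 0%N => //; left.
move: hq; set V := visited _ _ _ _.
suff gen : forall u, path (union_rel m m') u q -> u \in V -> last u q \in V by apply: gen.
elim: q => [|z q IH] u //= /andP[uz hq] hu.
apply: IH hq _; case/visitedP: hu => k kp hk.
case/orP: uz => /eqP ->.
  by apply/visitedP; exists k => //; case: hk => ->; [right | left; rewrite matchingK].
case: hk => ->.
  have e2 : val m' (walk m v k m') = val m (walk m v k.+1 m') by rewrite walkS matchingK.
  have [kp'|kp'] := ltnP k.+1 p; first by apply/visitedP; exists k.+1 => //; right.
  have -> : val m' (walk m v k m') = val m (walk m v 0 m').
    have kE : k.+1 = p by apply/eqP; rewrite eqn_leq kp kp'.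
    by rewrite e2 kE e'.
  by apply/visitedP; exists 0%N => //; right.
case: k kp => [|k] kp.
  have pE : p.-1.+1 = p by rewrite prednK.
  apply/visitedP; exists p.-1; first by rewrite pE.
  by left; rewrite [walk _ _ 0 _]/walk /= -[in LHS]e' -[in LHS]pE walkS !matchingK.
apply/visitedP; exists k; first exact: ltnW.
by left; rewrite walkS !matchingK.
Qed.

Lemma connect_union_sym n (m m' : matching n) : connect_sym (union_rel m m').
Proof.
apply: sym_connect_sym => a b; rewrite /union_rel.
by rewrite ![b == _]eq_sym (matching_sym m) (matching_sym m') ![_ == a]eq_sym.
Qed.

Lemma refines_connect n (r : 'I_(n.*2) -> 'I_(n.*2)) (m m' : matching n) x y :
  refines r m -> refines r m' -> connect (union_rel m m') x y -> r x = r y.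
Proof.
move=> rm rm' /connectP[p hp ->]; elim: p x hp => //= z p IH x /andP[xz hp].
rewrite -(IH z hp); case/orP: xz => /eqP ->; symmetry; apply/eqP.
  exact: (forallP rm).
exact: (forallP rm').
Qed.

Definition spans_rows n (r : 'I_(n.*2) -> 'I_(n.*2)) (m m' : matching n) : bool :=
  refines r m' && [forall x, forall y, connect (union_rel m m') x y == (r x == r y)].

(* On each row, the smaller endpoints of the edges of [m] are arranged in a cycle, and [m']
   joins the larger endpoint of every edge to the smaller endpoint of the next edge. *)
Lemma spans_rows_exists n (r : 'I_(n.*2) -> 'I_(n.*2)) (m : matching n) :
  refines r m -> exists m', spans_rows r m m'.
Proof.
move=> rm; have rmE x : r (val m x) = r x := eqP (forallP rm x).
pose low (x : 'I_(n.*2)) := (x < val m x)%N.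
have lowN x : low (val m x) = ~~ low x.
  by rewrite /low matchingK; have := matching_neq m x; rewrite -val_eqE /=; case: ltngtP.
pose L x := [seq y <- enum 'I_(n.*2) | low y && (r y == r x)].
have memL x y : (y \in L x) = low y && (r y == r x) by rewrite mem_filter mem_enum andbT.
have LE x y : r x = r y -> L x = L y by move=> e; apply: eq_filter => z; rewrite e.
have uL x : uniq (L x) by apply: filter_uniq; apply: enum_uniq.
pose f x := if low x then val m (prev (L x) x) else next (L x) (val m x).
have lowL x : low x -> x \in L x by move=> h; rewrite memL h eqxx.
have nlowL x : ~~ low x -> val m x \in L x by move=> h; rewrite memL lowN h rmE eqxx.
have rf x : r (f x) = r x.
  rewrite /f; case: ifP => [lx|/negbT lx].
    by have := mem_prev (L x) x; rewrite lowL // memL rmE => /andP[_ /eqP].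
  by have := mem_next (L x) (val m x); rewrite nlowL // memL => /andP[_ /eqP].
have lowf x : low (f x) = ~~ low x.
  rewrite /f; case: ifP => [lx|/negbT lx].
    by have := mem_prev (L x) x; rewrite lowL // memL lowN => /andP[-> _].
  by have := mem_next (L x) (val m x); rewrite nlowL // memL => /andP[-> _].
have fK : involutive f.
  move=> x; rewrite {1}/f lowf (LE _ _ (rf x)) /f.
  by case: (low x) => /=; rewrite ?matchingK ?(next_prev (uL x)) ?(prev_next (uL x)) ?matchingK.
have fN x : f x != x.
  by apply/eqP => e; have := lowf x; rewrite e; case: (low x).
have [m' m'E] := matching_of_invol fK fN.
have rm' : refines r m' by apply/forallP => x; rewrite m'E rf.
exists m'; rewrite /spans_rows rm' /=; apply/forallP => x; apply/forallP => y.
apply/eqP; apply/idP/eqP; first exact: refines_connect.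
set C := connect _.
have Cm a : C a (val m a) by apply: connect1; rewrite /union_rel eqxx.
have Cm' a : C a (val m' a) by apply: connect1; rewrite /union_rel eqxx orbT.
(* An edge of [m] followed by an edge of [m'] leads from a smaller endpoint to the next one in the
   cyclic order. *)
have nextC a u : u \in L a -> C u (next (L a) u).
  move=> ua; apply: connect_trans (Cm u) _.
  have := Cm' (val m u); rewrite m'E /f lowN; move: ua; rewrite memL => /andP[-> /eqP ra] /=.
  by rewrite matchingK (LE (val m u) a) // rmE.
have LC a u v : u \in L a -> v \in L a -> C u v.
  move=> ua va.
  have: fconnect (next (L a)) u v by rewrite (fconnect_cycle (cycle_next (uL a)) ua).
  move=> /connectP[p hp ->]; elim: p u ua hp => [|z p IH] u ua /=; first by rewrite /C connect0.
  move=> /andP[/eqP <- hp]; apply: connect_trans (nextC a u ua) _; apply: IH => //.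
  by rewrite mem_next.
have repC a : exists2 b, b \in L a & C a b /\ C b a.
  case la : (low a); first by exists a; [exact: lowL | rewrite /C connect0].
  exists (val m a); first by apply: nlowL; rewrite la.
  by split; rewrite // /C connect_union_sym; apply: Cm.
move=> exy; have [b bL [Cxb _]] := repC x; have [c cL [_ Ccy]] := repC y.
apply: connect_trans Cxb (connect_trans _ Ccy); apply: (LC x) => //.
by rewrite (LE _ _ exy).
Qed.

Lemma walk_row n (r : 'I_(n.*2) -> 'I_(n.*2)) (m m' : matching n) v i :
  refines r m -> refines r m' -> walk m v i m' \in row r (r v).
Proof.
move=> rm rm'; elim: i => [|i]; rewrite !inE // walkS.
by rewrite (eqP (forallP rm _)) (eqP (forallP rm' _)).
Qed.

Lemma visited_row n (r : 'I_(n.*2) -> 'I_(n.*2)) (m m' : matching n) v i :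
  refines r m -> refines r m' -> visited m m' v i \subset row r (r v).
Proof.
move=> rm rm'; apply/subsetP => x /visitedP[j _ [->|->]]; first exact: walk_row.
have := walk_row v j rm rm'; rewrite !inE => /eqP <-; exact: (forallP rm).
Qed.

(** The automorphism of [m] exchanges the edges of [w] and [z]. It serves to redirect a walk from
    [w] to [z] without disturbing the vertices off these edges. *)
Lemma matching_swap n (m : matching n) w z : exists g : {perm 'I_(n.*2)},
  [/\ g w = z, act g m = m &
   forall x, x \notin [:: w; z; val m w; val m z] -> g x = x] /\
  (forall x, g x = x \/ (x \in [:: w; z; val m w; val m z] /\ g x \in [:: w; z; val m w; val m z])).
Proof.
suff [g [gw gm gf]] : exists g : {perm 'I_(n.*2)},
    [/\ g w = z, act g m = m & forall x, x \notin [:: w; z; val m w; val m z] -> g x = x].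
  exists g; split=> // x.
  have [xin|xin] := boolP (x \in [:: w; z; val m w; val m z]); last by left; apply: gf.
  right; split=> //; apply/negPn/negP => gx.
  by have := gf _ gx => /perm_inj gxx; rewrite gxx xin in gx.
have actP (g : {perm 'I_(n.*2)}) : (forall x, g (val m x) = val m (g x)) -> act g m = m.
  by move=> h; apply: matching_eqP => x; rewrite actE h permKV.
have [->|wz] := eqVneq w z.
  by exists 1%g; split; rewrite ?perm1 ?act_id // => x _; rewrite perm1.
have [zmw|zmw] := eqVneq z (val m w).
  exists (tperm w z); split; first by rewrite tpermL.
    apply: actP => x; rewrite zmw; case: (tpermP w (val m w) x) => [->|->|/eqP xw /eqP xmw].
    - by rewrite tpermR matchingK.
    - by rewrite matchingK tpermL.
    rewrite tpermD // 1?eq_sym ?(inj_eq perm_inj) //.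
    by rewrite matching_sym eq_sym.
  by move=> x; rewrite !inE !negb_or => /and4P[h1 h2 _ _]; rewrite tpermD // eq_sym.
have zw : z != w by rewrite eq_sym.
have wmw := matching_neq m w; have zmz := matching_neq m z.
have mwz : val m w != z by rewrite eq_sym.
have mzw : val m z != w by rewrite matching_sym.
have mwmz : val m w != val m z by rewrite (inj_eq perm_inj).
have mzmw : val m z != val m w by rewrite (inj_eq perm_inj).
pose g := (tperm w z * tperm (val m w) (val m z))%g.
have gw : g w = z by rewrite permM tpermL tpermD.
have gz : g z = w by rewrite permM tpermR tpermD.
have gmw : g (val m w) = val m z.
  by rewrite permM (tpermD (z := val m w)) ?tpermL // eq_sym.
have gmz : g (val m z) = val m w.
  by rewrite permM (tpermD (z := val m z)) ?tpermR // eq_sym.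
have gf x : x \notin [:: w; z; val m w; val m z] -> g x = x.
  rewrite !inE !negb_or => /and4P[h1 h2 h3 h4].
  by rewrite permM !tpermD // eq_sym.
exists g; split=> //; apply: actP => x.
have [xin|xin] := boolP (x \in [:: w; z; val m w; val m z]); last first.
  rewrite [g x]gf // gf //; move: xin; rewrite !inE !negb_or => /and4P[h1 h2 h3 h4].
  by rewrite !(inj_eq perm_inj) !(matching_sym m x) ![_ == x]eq_sym h1 h2 h3 h4.
by move: xin; rewrite !inE => /or4P[] /eqP ->; rewrite ?matchingK ?gw ?gz ?gmw ?gmz ?matchingK.
Qed.

(** Such a set consists of whole edges, hence of equally many smaller and larger endpoints. *)
Lemma even_closed n (m : matching n) (A : {set 'I_(n.*2)}) :
  (forall x, x \in A -> val m x \in A) -> ~~ odd #|A|.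
Proof.
move=> hA; pose B := [set x in A | (x < val m x)%N].
have -> : A = B :|: [set val m x | x in B].
  apply/setP => x; rewrite !inE; apply/idP/orP => [xA|[/andP[]//|/imsetP[y]]].
    rewrite xA /=; case: (ltngtP x (val m x)) => [|h|/val_inj e]; first by left.
      right; apply/imsetP; exists (val m x); last by rewrite matchingK.
      by rewrite inE hA // matchingK.
    by have := matching_neq m x; rewrite -e eqxx.
  by rewrite inE => /andP[yA _] ->; apply: hA.
rewrite cardsU card_imset; last exact: perm_inj.
have -> : B :&: [set val m x | x in B] = set0; last by rewrite cards0 subn0 addnn odd_double.
apply/setP => x; rewrite !inE; apply/negP => /andP[/andP[_ h] /imsetP[y]].
by rewrite inE => /andP[_ h2] e; move: h h2; rewrite e matchingK; case: ltngtP.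
Qed.

Lemma spans_rowsP n (r : 'I_(n.*2) -> 'I_(n.*2)) (m m' : matching n) :
  reflect (refines r m' /\ forall x y, connect (union_rel m m') x y = (r x == r y))
    (spans_rows r m m').
Proof.
apply: (iffP andP) => -[h1 h2]; split=> //.
  by move=> x y; apply/eqP; apply: (forallP (forallP h2 x) y).
by apply/forallP => x; apply/forallP => y; rewrite h2.
Qed.

Lemma spans_rows_component n (r : 'I_(n.*2) -> 'I_(n.*2)) (m m' : matching n) v :
  spans_rows r m m' -> component m m' v = row r (r v).
Proof. by case/spans_rowsP => _ h; apply/setP => x; rewrite !inE h eq_sym. Qed.

(** Conjugate [m'] by an automorphism of [m] that takes the next walk vertex to [z]. It moves only
    unvisited vertices of the row, so the earlier walk is unchanged and the components are still the
    rows. *)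
Lemma spans_rows_next n (r : 'I_(n.*2) -> 'I_(n.*2)) (m m' : matching n) v i z :
  refines r m -> spans_rows r m m' -> (i.+1.*2 < #|row r (r v)|)%N ->
  z \in row r (r v) :\: visited m m' v i.+1 ->
  exists2 m2, spans_rows r m m2 &
    walk m v i.+1 m2 = z /\ forall j, (j <= i)%N -> walk m v j m2 = walk m v j m'.
Proof.
move=> rm sm hi /setDP[zrow zV]; have [rm' hm'] := spans_rowsP _ _ _ sm.
(* The row has even size above 2(i + 1), hence at least 2(i + 2), which gives one more injective
   step. *)
have winj : walk_inj_lt m m' v i.+2.
  move=> a b ab bi; apply: (@walk_inj_component _ m m' v i.+2) => //.
  rewrite (spans_rows_component v sm).
  have := card_visited_le m m' v i.+2.
  have even_row : ~~ odd #|row r (r v)|.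
    apply: (@even_closed _ m) => x; rewrite !inE => /eqP <-; exact: (forallP rm).
  move: hi even_row; clear; rewrite doubleS => h1 h2.
  have : (#|row r (r v)| != i.+1.*2.+1)%N by apply: contraNneq h2 => ->; rewrite /= odd_double.
  move: h1; lia.
have wrow := walk_row v i.+1 rm rm'.
set w := walk m v i.+1 m' in wrow *.
have wV : w \notin visited m m' v i.+1.
  apply/visitedP => -[j ji [e|e]].
    by have := winj _ _ ji (ltnSn _); rewrite -e eqxx.
  by have := walk_neq m m' v i.+1 j; rewrite -/w e eqxx.
have visM x : (val m x \in visited m m' v i.+1) = (x \in visited m m' v i.+1).
  have sub y : y \in visited m m' v i.+1 -> val m y \in visited m m' v i.+1.
    case/visitedP => j ji [->|->]; apply/visitedP; exists j => //; first by right.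
    by left; rewrite matchingK.
  by apply/idP/idP => [/sub|/sub //]; rewrite matchingK.
have [g [[gw gm gf] gin]] := matching_swap m w z.
have inV x : x \in [:: w; z; val m w; val m z] -> x \notin visited m m' v i.+1.
  by rewrite !in_cons in_nil orbF => /or4P[] /eqP -> //; rewrite visM.
have gV x : x \in visited m m' v i.+1 -> g x = x.
  by move=> hx; apply: gf; apply: contraL hx; apply: inV.
have rin x : x \in [:: w; z; val m w; val m z] -> r x = r v.
  move: wrow zrow; rewrite !inE => /eqP rw /eqP rz.
  have rmE y : r (val m y) = r y := eqP (forallP rm y).
  by case/or4P => /eqP -> //; rewrite rmE.
have rg x : r (g x) = r x.
  by case: (gin x) => [->//|[h1 h2]]; rewrite (rin _ h1) (rin _ h2).
have act_g x : val m (g x) = g (val m x) by rewrite -{1}gm actEg.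
have wE j : (j <= i.+1)%N -> walk m v j (act g m') = g (walk m v j m').
  have vV j' : (j' <= i)%N -> walk m v j' m' \in visited m m' v i.+1.
    by move=> h; apply/visitedP; exists j' => //; left.
  elim: j => [|j IH] ji; first by rewrite [LHS](_ : _ = v) // gV //; apply: (vV 0%N).
  by rewrite !walkS IH 1?ltnW // actEg act_g.
exists (act g m').
  apply/spans_rowsP; split.
    apply/forallP => x; rewrite -[x](permKV g) actEg !rg; exact: (forallP rm').
  move=> x y; rewrite -[x](permKV g) -[y](permKV g) -{1}gm connect_act hm'.
  by rewrite !rg.
split; first by rewrite wE.
move=> j ji; rewrite wE 1?leqW // gV //; apply/visitedP; exists j => //; by left.
Qed.

(** After [i] steps the walk may continue to any of the 2N - 2(i + 1) unvisited vertices of the row;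
    over N - 1 steps these choices multiply to (2N - 2)!!. *)
Lemma card_spans_rows_ge n (r : 'I_(n.*2) -> 'I_(n.*2)) (m : matching n) v N :
  refines r m -> #|row r (r v)| = N.*2 -> (dfact2 N.-1 <= #|[set m' | spans_rows r m m']|)%N.
Proof.
move=> rm hN; have [m0 hm0] := spans_rows_exists rm.
rewrite -(@dfact2_prod N.-1 N.-1 (leqnn _)) subnn muln1.
apply: (@card_ge_chain _ _ _ (walk m v) (fun i => N.-1.*2 - i.*2)%N _ m0) => //.
  by rewrite inE.
move=> i s iN; rewrite inE => hs.
have rs : refines r s by case/andP: hs.
apply: (@leq_trans #|row r (r v) :\: visited m s v i.+1|).
  rewrite cardsD (setIidPr (visited_row v i.+1 rm rs)) hN.
  have := card_visited_le m s v i.+1; lia.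
apply: subset_leq_card; apply/subsetP => z hz.
have [|m2 h2 [hz2 h]] := spans_rows_next rm hs _ hz; first by rewrite hN ltn_double; lia.
by rewrite -hz2; apply: imset_f; apply/agreeP; split=> //; rewrite inE.
Qed.

Definition agree_on n (V : {set 'I_(n.*2)}) (s : matching n) : {set matching n} :=
  [set m' : matching n | [forall x, (x \in V) ==> (val m' x == val s x)]].

Lemma agree_onP n (V : {set 'I_(n.*2)}) (s m' : matching n) :
  reflect (forall x, x \in V -> val m' x = val s x) (m' \in agree_on V s).
Proof.
rewrite inE; apply: (iffP forallP) => h x; first by move=> xV; apply/eqP/(implyP (h x)).
by apply/implyP => xV; rewrite h.
Qed.

(** The constant [v] outside [V] makes restrictions comparable as functions on all vertices and lets
    them be counted as partial functions. *)
Definition restriction n (V : {set 'I_(n.*2)}) v (m' : matching n) : {ffun 'I_(n.*2) -> 'I_(n.*2)} :=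
  [ffun x => if x \in V then val m' x else v].

Lemma card_restriction_le n (V : {set 'I_(n.*2)}) v (S : {set matching n}) :
  (forall s, s \in S -> forall x, x \in V -> val s x \in V) ->
  (#|restriction V v @: S| <= #|V| ^ #|V|)%N.
Proof.
move=> hS; rewrite -(card_pffun_on v V V); apply: subset_leq_card.
apply/subsetP => _ /imsetP[s hs ->]; apply/pffun_onP; split.
  by apply/subsetP => x; rewrite inE ffunE; case: ifP => // _; rewrite eqxx.
by move=> _ /imageP[x xV ->]; rewrite ffunE xV hS.
Qed.

Lemma card_agree_on_le n (V : {set 'I_(n.*2)}) (s : matching n) (v : 'I_(n.*2)) :
  (forall x, x \in V -> val s x \in V) ->
  (#|agree_on V s| <= #|~: V| ^ #|~: V|)%N.
Proof.
move=> hV; have closed s' : s' \in agree_on V s ->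
    forall x, x \in ~: V -> val s' x \in ~: V.
  move=> /agree_onP h x; rewrite !inE; apply: contra => hx.
  by have := hV _ hx; rewrite -h // matchingK.
rewrite -(@card_in_imset _ _ (restriction (~: V) v)); first exact: card_restriction_le.
move=> s1 s2 /agree_onP h1 /agree_onP h2 /ffunP e; apply: matching_eqP => x.
have [xV|xV] := boolP (x \in V); first by rewrite h1 // h2.
by have := e x; rewrite !ffunE inE xV.
Qed.

(** The edges of [A] are released one by one. With k edges still prescribed, a free vertex [x] has
    2n - 2k - 1 possible partners, and the transposition of [m x] with the chosen partner carries
    the matchings containing {x, m x} injectively to those with that partner. *)
Lemma card_agree_on_prod n (m : matching n) k (A : {set 'I_(n.*2)}) :
  (forall x, x \in A -> val m x \in A) -> #|A| = k.*2 ->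
  ((\prod_(i < k) (n.*2 - i.*2 - 1)) * #|agree_on A m| <= #|[set: matching n]|)%N.
Proof.
elim: k A => [|k IH] A hA cA.
  by rewrite big_ord0 mul1n; apply: subset_leq_card; apply/subsetP => x; rewrite inE.
have [x xA] : exists x, x \in A by apply/card_gt0P; rewrite cA.
pose A0 := A :\: [set x; val m x].
have hA0 y : y \in A0 -> val m y \in A0.
  rewrite !inE !negb_or => /andP[/andP[yx ymx] yA]; rewrite hA // andbT.
  by rewrite (inj_eq perm_inj) yx andbT matching_sym eq_sym.
have cA0 : #|A0| = k.*2.
  rewrite cardsD (setIidPr _); last by apply/subsetP => y; rewrite !inE => /orP[] /eqP ->; rewrite ?hA.
  by rewrite cards2 eq_sym matching_neq cA doubleS subn2.
apply: leq_trans (IH A0 hA0 cA0).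
rewrite big_ord_recr /= -mulnA leq_mul2l; apply/orP; right.
have xA0 : x \notin A0 by rewrite !inE eqxx.
have mxA0 : val m x \notin A0 by rewrite !inE eqxx orbT.
pose g y := tperm (val m x) y.
have gP y s : y \notin A0 -> y != x -> s \in agree_on A0 m -> val s x = val m x ->
    act (g y) s \in agree_on A0 m /\ val (act (g y) s) x = y.
  move=> yA0 yx /agree_onP hs sx; split.
    have gz z : z \in A0 -> g y z = z.
      by move=> zA; apply: tpermD; [apply: contraNneq mxA0 => -> | apply: contraNneq yA0 => ->].
    apply/agree_onP => z zA0; rewrite -{1}(gz z zA0) actEg hs // gz //.
    exact: hA0.
  have gx : g y x = x by apply: tpermD => //; exact: matching_neq.
  by rewrite -{1}gx actEg sx tpermL.
have mA0 : m \in agree_on A0 m by apply/agree_onP.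
apply: (@card_ge_fibers _ _ _ (fun s : matching n => val s x)).
  apply: (@leq_trans #|~: (x |: A0)|).
    by rewrite cardsCs setCK cardsU1 xA0 cA0 card_ord; lia.
  apply: subset_leq_card; apply/subsetP => y; rewrite in_setC in_setU1 negb_or => /andP[yx yA0'].
  have [h1 h2] := gP y m yA0' yx mA0 erefl.
  by rewrite -h2; apply: imset_f.
move=> s hs; have hs' := agree_onP _ _ _ hs.
have sxA0 : val s x \notin A0.
  by apply/negP => h; have := hA0 _ h; rewrite -hs' // matchingK (negbTE xA0).
rewrite -(card_imset (mem (agree_on A m)) (@act_inj n (g (val s x)))); apply: subset_leq_card.
apply/subsetP => _ /imsetP[s2 /agree_onP h2 ->].
have [|h3 h4] := gP _ s2 sxA0 (matching_neq s x) _ (h2 x xA).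
  by apply/agree_onP => z /setDP[zA _]; apply: h2.
by rewrite inE h3 h4 eqxx.
Qed.

Lemma leq_expnn a b : (a <= b)%N -> (a ^ a <= b ^ b)%N.
Proof.
case: a => [|a]; first by rewrite expn0 => _; case: b => [|b] //; rewrite expn_gt0.
move=> ab; apply: (@leq_trans (b ^ a.+1)); first by rewrite leq_exp2r.
by rewrite leq_pexp2l //; apply: leq_trans ab.
Qed.

(* The first [K] steps of the walk determine [m'] outside at most [2n - 2K] vertices. *)
Lemma card_agree_walk n (m s : matching n) v K (S : {set matching n}) :
  walk_inj_lt m s v K.+1 ->
  (#|agree S (walk m v) K s| <= (n.*2 - K.*2) ^ (n.*2 - K.*2))%N.
Proof.
(* The first [K] steps use the edges of [m'] joining w_j to m w_(j+1) for j < K. Their endpoints are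
   the visited vertices without the two loose ends w_K and m v. *)
move=> winj; pose V := visited m s v K.+1 :\: [set walk m v K s; val m v].
have VP x : reflect (exists2 j, (j < K)%N & x = walk m v j s \/ x = val m (walk m v j.+1 s)) (x \in V).
  apply: (iffP setDP) => [[/visitedP[j jK hx]]|[j jK hx]].
    rewrite in_set2 negb_or => /andP[xK xv]; case: hx => hx.
      exists j; last by left.
      by rewrite ltn_neqAle -ltnS jK andbT; apply: contraNneq xK => <-; rewrite hx.
    case: j jK hx => [|j] jK hx; first by rewrite hx eqxx in xv.
    by exists j; [| right].
  split.
    by apply/visitedP; case: hx => ->; [exists j; [exact: ltnW | left] | exists j.+1; [|right]].
  rewrite !inE negb_or; case: hx => ->.
    rewrite winj //=; exact: (walk_neq m s v j 0).
  rewrite eq_sym walk_neq (inj_eq perm_inj) andTb eq_sym; exact: (winj 0%N j.+1).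
have VE m' : (forall j, (j <= K)%N -> walk m v j m' = walk m v j s) -> forall x, x \in V ->
    val m' x = val s x.
  move=> hw x /VP[j jK [->|->]].
    rewrite -{1}(hw j) ?(ltnW jK) //; apply: (@perm_inj _ (val m)).
    by rewrite -!walkS hw.
  by rewrite -{1}(hw j.+1) // !walkS !matchingK hw // ltnW.
have Vs x : x \in V -> val s x \in V.
  move=> /VP[j jK [->|->]]; apply/VP; exists j => //.
    by right; rewrite walkS matchingK.
  by left; rewrite walkS !matchingK.
apply: (@leq_trans #|agree_on V s|).
  apply: subset_leq_card; apply/subsetP => m' /agreeP[_ hw]; apply/agree_onP; exact: VE.
apply: leq_trans (card_agree_on_le v Vs) _; apply: leq_expnn.
rewrite cardsCs setCK card_ord leq_sub2l // /V cardsD.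
have := card_visited winj.
have : (#|visited m s v K.+1 :&: [set walk m v K s; val m v]| <= 2)%N.
  apply: leq_trans (subset_leq_card (subsetIr _ _)) _; rewrite cards2; by case: (_ != _).
lia.
Qed.

(** A large component keeps the walk injective, so the next vertex lies in the row outside the 2(i +
    1) visited ones. The final factor bounds the completions after [K] steps. *)
Lemma card_large_component_le n (r : 'I_(n.*2) -> 'I_(n.*2)) (m : matching n) v N K :
  refines r m -> #|row r (r v)| = N.*2 -> (K < N)%N ->
  (#|[set m' | refines r m' & K.+1.*2 <= #|component m m' v|]|
    <= dfact2 N.-1 * (n.*2 - K.*2) ^ (n.*2 - K.*2))%N.
Proof.
move=> rm hN KN; set S := [set m' | _].
apply: (@leq_trans ((\prod_(i < K) (N.-1.*2 - i.*2)) * (n.*2 - K.*2) ^ (n.*2 - K.*2))%N).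
  have SP s : s \in S -> refines r s /\ walk_inj_lt m s v K.+1.
    by rewrite inE => /andP[h1 h2]; split=> //; apply: walk_inj_component.
  apply: (@card_le_chain _ _ S (walk m v) (fun i => N.-1.*2 - i.*2)%N) => //.
    move=> i s iK hs; have [rs ws] := SP s hs.
    apply: (@leq_trans #|row r (r v) :\: visited m s v i.+1|).
      apply: subset_leq_card; apply/subsetP => _ /imsetP[s' /agreeP[hs' hw] ->].
      have [rs' ws'] := SP s' hs'.
      apply/setDP; split; first exact: walk_row.
      apply/visitedP => -[j ji]; rewrite -hw // => -[/eqP|/eqP].
        by rewrite eq_sym (negbTE (ws' j i.+1 ji iK)).
      by rewrite (negbTE (walk_neq _ _ _ _ _)).
    rewrite cardsD (setIidPr (visited_row v i.+1 rm rs)) hN card_visited; first by lia.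
    by move=> a b ab bi; apply: ws => //; lia.
  by move=> s hs; apply: card_agree_walk; case: (SP s hs).
rewrite leq_mul2r -(@dfact2_prod N.-1 K) ?leq_pmulr ?dfact2_gt0 ?orbT //; lia.
Qed.

Lemma component_eq n (m m' : matching n) v w : v \in component m m' w ->
  component m m' v = component m m' w.
Proof.
rewrite inE => h; apply/setP => x; rewrite !inE.
by rewrite (same_connect (@connect_union_sym n m m') h).
Qed.

(* A component with [2(n - t)] vertices meets every set of [2t + 1] vertices, so it may be
   assumed to pass through one of [2t + 1] fixed vertices of the large row. *)
Lemma card_long_cycle_le n t (r : 'I_(n.*2) -> 'I_(n.*2)) (m : matching n) v N :
  (t.*2 < n)%N -> refines r m -> #|row r (r v)| = N.*2 -> (n - t <= N)%N ->
  (#|[set m' | refines r m' & [exists w, (n - t).*2 <= #|component m m' w|]]|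
    <= t.*2.+1 * (dfact2 N.-1 * t.+1.*2 ^ t.+1.*2))%N.
Proof.
move=> tn rm hN ntN; set S := [set m' | _].
pose Z := [set x in take t.*2.+1 (enum (row r (r v)))].
have cZ : #|Z| = t.*2.+1.
  rewrite cardsE; have /card_uniqP -> : uniq (take t.*2.+1 (enum (row r (r v)))).
    by apply: take_uniq; apply: enum_uniq.
  by rewrite size_take -cardE hN; case: ltnP => //; lia.
have Zrow z : z \in Z -> r z = r v.
  by rewrite inE => /mem_take; rewrite mem_enum inE => /eqP.
(* With this length, 2n - 2K = 2(t + 1), so the factor left after the walk depends on t only. *)
pose K := (n - t).-1; have KE : K.+1 = (n - t)%N by rewrite /K; lia.
pose Sz z := [set m' | refines r m' & (K.+1.*2 <= #|component m m' z|)%N].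
apply: (@leq_trans (\sum_(z in Z) #|Sz z|)%N); last first.
  rewrite -cZ -sum_nat_const; apply: leq_sum => z zZ.
  have -> : t.+1.*2 = (n.*2 - K.*2)%N by lia.
  by apply: card_large_component_le => //; [rewrite (Zrow z zZ) | lia].
apply: (@leq_trans #|\bigcup_(z in Z) Sz z|).
  apply: subset_leq_card; apply/subsetP => m'; rewrite inE => /andP[rm' /existsP[w hw]].
  have [z zC] : exists z, z \in Z :&: component m m' w.
    apply/card_gt0P; have := cardsUI Z (component m m' w).
    have : (#|Z :|: component m m' w| <= n.*2)%N.
      by rewrite -[X in (_ <= X)%N](card_ord n.*2) max_card.
    rewrite cZ; lia.
  case/setIP: zC => zZ zC; apply/bigcupP; exists z => //.
  by rewrite inE rm' (component_eq zC) KE.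
elim/big_rec2: _ => [|z a A _ IH]; first by rewrite cards0.
apply: leq_trans (leq_card_setU _ _) _; by rewrite leq_add2l.
Qed.

(** * Shapes and cycle types *)

Lemma count_ptoseq n (l : part n) a :
  count (fun b => (a < b)%N) (ptoseq l) = #|[set i : 'I_n | (a < pv l i)%N]|.
Proof.
rewrite /ptoseq count_map count_filter -sum1_count big_enum_cond -sum1_card.
apply: eq_bigl => i; rewrite !inE /=.
by case: (ltnP a (pv l i)) => // h; rewrite (leq_ltn_trans _ h).
Qed.

(** The counts of parts above [a] form the conjugate partition, from which the parts are
    recovered. *)
Lemma ltn_pv n (l : part n) a (i : 'I_n) :
  (a < pv l i)%N = (i < count (fun b => a < b) (ptoseq l))%N.
Proof.
rewrite count_ptoseq; apply/idP/idP => [h|].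
  rewrite -[X in (X <= _)%N](@card_ord_lt n i.+1) //; apply: subset_leq_card.
  apply/subsetP => j; rewrite !inE ltnS => ji; apply: leq_trans h _; exact: pv_anti.
apply: contraTT; rewrite -!leqNgt => h.
rewrite -[X in (_ <= X)%N](@card_ord_lt n i) ?(ltnW (ltn_ord i)) //; apply: subset_leq_card.
apply/subsetP => j; rewrite !inE; apply: contraTT; rewrite -!leqNgt => ij.
apply: leq_trans h; exact: pv_anti.
Qed.

Lemma ptoseq_pos n (l : part n) b : b \in ptoseq l -> (0 < b)%N.
Proof. by case/mapP => i; rewrite mem_filter => /andP[h _] ->. Qed.

Lemma size_ptoseq n (l : part n) : size (ptoseq l) = count (fun b => 0 < b)%N (ptoseq l).
Proof.
apply/esym/eqP; rewrite -all_count; apply/allP => b; exact: ptoseq_pos.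
Qed.

Lemma ptoseq_inj n : injective (@ptoseq n).
Proof.
move=> l l' e; apply/val_inj/ffunP => i; apply: val_inj; change (pv l i = pv l' i).
have h a : (a < pv l i)%N = (a < pv l' i)%N by rewrite !ltn_pv e.
apply/eqP; rewrite eqn_leq; apply/andP; split; rewrite leqNgt; apply/negP.
  by rewrite h ltnn.
by rewrite -h ltnn.
Qed.

Lemma pv_mem_ptoseq n (l : part n) (i : 'I_n) : (0 < pv l i)%N -> pv l i \in ptoseq l.
Proof. by move=> h; apply: map_f; rewrite mem_filter h mem_enum. Qed.

(** The parts after the first sum to at most t, so at most t of them are nonzero. *)
Lemma fat_parts_size n t (l : part n) (i0 : 'I_n) :
  (t < n)%N -> i0 = 0%N :> nat -> fat_parts t l i0 -> (size (ptoseq l) <= t.+1)%N.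
Proof.
move=> tn i00 [h1 _]; rewrite size_ptoseq count_ptoseq.
have := pv_sum l; rewrite (bigD1 i0) //= => h.
have h2 : (\sum_(i < n | i != i0) pv l i <= t)%N by rewrite -(leq_add2l (pv l i0)) h; lia.
rewrite (cardsD1 i0); set b := (_ \in _).
suff : (#|[set i | (0 < pv l i)%N] :\ i0| <= t)%N by move=> h3; exact: (leq_add (leq_b1 b) h3).
apply: leq_trans h2; rewrite -sum1_card big_mkcond [in X in (_ <= X)%N]big_mkcond /=.
apply: leq_sum => i _; rewrite !inE; by case: (i != i0) => //=; case: ltnP.
Qed.

Lemma part_of_seq n (s : seq nat) : sorted geq s -> all (fun b => 0 < b)%N s -> sumn s = n ->
  exists l : part n, ptoseq l = s.
Proof.
move=> ss sp sn.
have szn : (size s <= n)%N.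
  rewrite -sn; elim: s sp {ss sn} => //= b s IH /andP[b0 /IH h]; by rewrite -addn1 addnC leq_add.
have nthn i : (nth 0 s i < n.+1)%N.
  rewrite ltnS -sn; elim: s i {ss sp sn szn} => [|b s IH] [|i] //=; first exact: leq_addr.
  by apply: leq_trans (IH i) _; exact: leq_addl.
have e : [seq nth 0%N s (val i) | i <- enum 'I_n] =
    s ++ [seq nth 0%N s i | i <- iota (size s) (n - size s)].
  rewrite (map_comp (nth 0%N s) val) val_enum_ord -{1}(subnKC szn) iotaD map_cat add0n.
  by congr (_ ++ _); exact: mkseq_nth.
pose f : {ffun 'I_n -> 'I_n.+1} := [ffun i : 'I_n => Ordinal (nthn i)].
have fp : partb f.
  apply/andP; split.
    apply/forallP => i; apply/forallP => j; apply/implyP => ij; rewrite !ffunE /=.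
    have [js|js] := ltnP j (size s); last by rewrite nth_default.
    have trg : transitive geq by move=> a b c h1 h2; apply: leq_trans h2 h1.
    exact: (sorted_leq_nth trg leqnn 0%N ss i j (leq_ltn_trans ij js) js ij).
  apply/eqP; rewrite (eq_bigr (fun i : 'I_n => nth 0%N s i)); last by move=> i _; rewrite ffunE.
  rewrite -[RHS]sn sumnE -[LHS](big_map (fun i : 'I_n => nth 0%N s i) xpredT id) /index_enum.
  rewrite -enumT e big_cat /= [X in (_ + X)%N]big1_seq ?addn0 // => b /andP[_ /mapP[i]].
  by rewrite mem_iota => /andP[h _] ->; rewrite nth_default.
exists (exist (fun l => partb l) f fp).
have -> : ptoseq (exist (fun l => partb l) f fp) =
    [seq b <- [seq nth 0%N s (val i) | i <- enum 'I_n] | (0 < b)%N].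
  rewrite /ptoseq filter_map; rewrite (@eq_filter _ _ (preim (fun i : 'I_n => nth 0%N s (val i)) (fun b => (0 < b)%N))).
    by apply: eq_map => i; rewrite /pv /= ffunE.
  by move=> i; rewrite /pv /= ffunE.
rewrite e filter_cat (all_filterP sp) [X in _ ++ X](_ : _ = [::]) ?cats0 //.
apply/eqP; rewrite -size_eq0 size_filter -leqn0 leqNgt -has_count; apply/hasPn => b /mapP[i].
by rewrite mem_iota => /andP[h _] ->; rewrite nth_default.
Qed.

Definition rows n (r : 'I_(n.*2) -> 'I_(n.*2)) : {set {set 'I_(n.*2)}} :=
  [set row r (r x) | x : 'I_(n.*2)].

(** The form copies [cycle_type], so that comparing the two reduces to comparing rows with
    components. *)
Definition shape n (r : 'I_(n.*2) -> 'I_(n.*2)) : seq nat :=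
  sort geq [seq (#|C| %/ 2)%N | C : {set 'I_(n.*2)} <- enum (rows r)].

Lemma row_even n (r : 'I_(n.*2) -> 'I_(n.*2)) (m : matching n) i : refines r m ->
  #|row r i| = (#|row r i| %/ 2).*2.
Proof.
move=> rm; rewrite -[RHS]muln2 divnK // dvdn2.
by apply: (@even_closed _ m) => x; rewrite !inE => /eqP <-; exact: (forallP rm).
Qed.

Lemma size_shape n (r : 'I_(n.*2) -> 'I_(n.*2)) : size (shape r) = #|rows r|.
Proof. by rewrite size_sort size_map -cardE. Qed.

Lemma size_cycle_type n (m m' : matching n) : size (cycle_type m m') = #|union_comps m m'|.
Proof. by rewrite size_sort size_map -cardE. Qed.

Lemma mem_shape n (r : 'I_(n.*2) -> 'I_(n.*2)) b :
  reflect (exists x, b = (#|row r (r x)| %/ 2)%N) (b \in shape r).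
Proof.
rewrite mem_sort; apply: (iffP mapP) => [[C]|[x ->]].
  by rewrite mem_enum => /imsetP[x _ ->] ->; exists x.
by exists (row r (r x)); rewrite // mem_enum; apply: imset_f.
Qed.

Lemma mem_cycle_type n (m m' : matching n) b :
  reflect (exists x, b = (#|component m m' x| %/ 2)%N) (b \in cycle_type m m').
Proof.
rewrite mem_sort; apply: (iffP mapP) => [[C]|[x ->]].
  by rewrite mem_enum => /imsetP[x _ ->] ->; exists x.
by exists (component m m' x); rewrite // mem_enum; apply: imset_f.
Qed.

Lemma spans_rows_cycle_type n (r : 'I_(n.*2) -> 'I_(n.*2)) (m m' : matching n) :
  spans_rows r m m' -> cycle_type m m' = shape r.
Proof.
move=> h; rewrite /cycle_type /shape; suff -> : union_comps m m' = rows r by [].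
by apply: eq_imset => x; rewrite -[LHS]/(component m m' x) (spans_rows_component x h).
Qed.

(** Each component lies in one row, and this map from components to rows is onto. If the numbers
    agree it is injective, so every row is a single component. *)
Lemma refines_cycle_type n (r : 'I_(n.*2) -> 'I_(n.*2)) (m m' : matching n) :
  refines r m -> refines r m' ->
  cycle_type m m' = shape r \/ (size (shape r) < size (cycle_type m m'))%N.
Proof.
move=> rm rm'; rewrite size_shape size_cycle_type.
pose g (C : {set 'I_(n.*2)}) := [set y | [exists x in C, r y == r x]].
have gE x : g [set y | connect (union_rel m m') x y] = row r (r x).
  apply/setP => y; rewrite !inE; apply/exists_inP/idP => [[z]|h].
    by rewrite inE => /(refines_connect rm rm') ->.
  by exists x; rewrite // inE connect0.
have rowsE : rows r = g @: union_comps m m'.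
  by rewrite /union_comps -imset_comp; apply: eq_imset => x /=; rewrite gE.
have [e|ne] := eqVneq #|rows r| #|union_comps m m'|; last first.
  by right; rewrite ltn_neqAle ne rowsE leq_imset_card.
left; apply: spans_rows_cycle_type; apply/spans_rowsP; split=> // x y.
apply/idP/eqP => [|exy]; first exact: refines_connect.
have /imset_injP inj : #|g @: union_comps m m'| == #|union_comps m m'| by rewrite -rowsE e.
have : g [set z | connect (union_rel m m') x z] = g [set z | connect (union_rel m m') y z].
  by rewrite !gE exy.
move=> /inj h; have {}h := h (imset_f _ isT) (imset_f _ isT).
by have := in_set (fun z => connect (union_rel m m') x z) y; rewrite h inE connect0.
Qed.

Lemma sum_rows n (r : 'I_(n.*2) -> 'I_(n.*2)) : (\sum_(C in rows r) #|C|)%N = n.*2.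
Proof.
rewrite -[RHS](card_ord n.*2) -[in RHS]cardsT (card_fibers _ (fun x => row r (r x))).
have -> : (fun x => row r (r x)) @: [set: 'I_(n.*2)] = rows r by apply/setP => C; apply/imsetP/imsetP => -[x _ ->]; exists x.
apply: eq_bigr => _ /imsetP[x _ ->]; apply: eq_card => y; rewrite !inE.
apply/eqP/eqP => [->//|/setP/(_ y)]; by rewrite !inE eqxx => /esym/eqP.
Qed.

Lemma shape_part n (r : 'I_(n.*2) -> 'I_(n.*2)) (m : matching n) : refines r m ->
  exists l : part n, ptoseq l = shape r.
Proof.
move=> rm; apply: part_of_seq.
- by apply: sort_sorted => a b; rewrite /geq /= leq_total.
- apply/allP => b /mem_shape[x ->]; have := row_even (r x) rm; have := row_gt0 r x; lia.
have -> : sumn (shape r) = sumn [seq (#|C| %/ 2)%N | C : {set 'I_(n.*2)} <- enum (rows r)].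
  by apply: perm_sumn; rewrite perm_sort.
rewrite sumnE big_map big_enum /=; apply: double_inj; rewrite -[RHS](sum_rows r).
rewrite -[LHS]muln2 big_distrl /=; apply: eq_bigr => _ /imsetP[x _ ->].
by rewrite muln2 -(row_even _ rm).
Qed.

Lemma wide_fatp n t (r : 'I_(n.*2) -> 'I_(n.*2)) (m : matching n) (l : part n) :
  (t.*2 < n)%N -> wide t r -> refines r m -> ptoseq l = shape r -> fatp t l.
Proof.
move=> tn /existsP[x /andP[h1 h2]] rm e.
have n0 : (0 < n)%N by lia.
pose i0 := Ordinal n0; apply: (@parts_fatp _ _ _ i0) => //.
have : (#|row r (r x)| %/ 2)%N \in ptoseq l by rewrite e; apply/mem_shape; exists x.
case/mapP => j _ hj; have := pv_anti l (leq0n j : (i0 <= j)%N) => hj0.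
have ev := row_even (r x) rm.
split; first by lia.
case/orP: h2 => h2; [left; lia | right => i ti].
apply/eqP; rewrite -leqn0 leqNgt ltn_pv -size_ptoseq e size_shape -leqNgt.
apply: leq_trans ti; apply: leq_trans h2.
apply: leq_trans (leq_imset_card (row r) _); apply: subset_leq_card.
apply/subsetP => _ /imsetP[y _ ->]; apply/imset_f/imset_f; exact: in_setT.
Qed.

Lemma fatp_large_row n t (r : 'I_(n.*2) -> 'I_(n.*2)) (m : matching n) (l : part n) :
  (t.*2 < n)%N -> fatp t l -> refines r m -> ptoseq l = shape r ->
  exists v N, #|row r (r v)| = N.*2 /\ (n - t <= N)%N.
Proof.
move=> tn hl rm e; have n0 : (0 < n)%N by lia.
pose i0 := Ordinal n0; have tn' : (t < n)%N by lia.
have [h1 _] := fatp_parts tn' (erefl : i0 = 0%N :> nat) hl.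
have : pv l i0 \in shape r by rewrite -e; apply: pv_mem_ptoseq; lia.
case/mem_shape => x hx; exists x, (pv l i0); split=> //.
by rewrite hx -(row_even _ rm).
Qed.

Lemma fatp_long_cycle n t (l : part n) (m m' : matching n) :
  (t.*2 < n)%N -> fatp t l -> cycle_type m m' = ptoseq l ->
  [exists w, (n - t).*2 <= #|component m m' w|]%N.
Proof.
move=> tn hl e; have n0 : (0 < n)%N by lia.
pose i0 := Ordinal n0; have tn' : (t < n)%N by lia.
have [h1 _] := fatp_parts tn' (erefl : i0 = 0%N :> nat) hl.
have : pv l i0 \in cycle_type m m' by rewrite e; apply: pv_mem_ptoseq; lia.
case/mem_cycle_type => x hx; apply/existsP; exists x.
have := leq_divM #|component m m' x| 2; lia.
Qed.

(** Vertices are ranked by the position of their row in a list sorted by size. Refinement makes row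
    sizes even, so the shape determines how often each rank occurs and the two rankings differ by a
    permutation. *)
Lemma conj_of_shape n (r r' : 'I_(n.*2) -> 'I_(n.*2)) (m m' : matching n) :
  refines r m -> refines r' m' -> shape r = shape r' ->
  exists g : {perm 'I_(n.*2)}, forall x y, (r' (g x) == r' (g y)) = (r x == r y).
Proof.
move=> rm rm' e.
pose half (C : {set 'I_(n.*2)}) := (#|C| %/ 2)%N.
pose Bs (q : 'I_(n.*2) -> 'I_(n.*2)) := sort (relpre half geq) (enum (rows q)).
pose rk (q : 'I_(n.*2) -> 'I_(n.*2)) x := index (row q (q x)) (Bs q).
have memB q x : row q (q x) \in Bs q by rewrite mem_sort mem_enum; apply: imset_f.
have rkE q x y : (rk q x == rk q y) = (q x == q y).
  apply/eqP/eqP => [h|]; last by rewrite /rk => ->.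
  have : row q (q x) = row q (q y).
    by rewrite -(nth_index set0 (memB q x)) -(nth_index set0 (memB q y)) -/(rk q x) h.
  by move=> /setP/(_ x); rewrite !inE eqxx => /esym/eqP.
have cnt q m1 i : refines q m1 -> #|[set x | rk q x == i]| = (nth 0%N (shape q) i).*2.
  move=> qm; have shE : shape q = map half (Bs q) by rewrite /shape sort_map.
  have [iB|iB] := ltnP i (size (Bs q)); last first.
    rewrite nth_default ?shE ?size_map //; apply/eqP; rewrite cards_eq0; apply/eqP/setP => x.
    by rewrite !inE; apply/negbTE; rewrite neq_ltn (leq_trans _ iB) // index_mem.
  rewrite shE (nth_map set0) //.
  have : nth set0 (Bs q) i \in Bs q by apply: mem_nth.
  rewrite mem_sort mem_enum => /imsetP[y _ hy].
  have rky : rk q y = i.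
    by rewrite /rk -hy index_uniq // sort_uniq enum_uniq.
  rewrite hy /half -(row_even _ qm); apply: eq_card => x.
  by rewrite !inE -{1}rky rkE.
have pe : perm_eq [tuple rk r i | i < n.*2] [tuple rk r' i | i < n.*2].
  rewrite /perm_eq; apply/allP => i _; apply/eqP.
  have cE q : count_mem i [tuple rk q x | x < n.*2] = #|[set x | rk q x == i]|.
    rewrite count_map -sum1_count big_enum_cond -sum1_card.
    by apply: eq_bigl => x; rewrite !inE.
  by rewrite !cE (cnt _ _ _ rm) (cnt _ _ _ rm') e.
have /tuple_permP[p hp] := pe.
exists p => x y.
have hx z : rk r z = rk r' (p z).
  have /val_inj h := hp.
  have := congr1 (fun u : (n.*2).-tuple nat => tnth u z) h.
  by rewrite !tnth_mktuple.
by rewrite -rkE -!hx rkE.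
Qed.

(** * The pair counts K(r, rho) and their bounds *)

Definition cyc_count n (r : 'I_(n.*2) -> 'I_(n.*2)) (s : seq nat) : nat :=
  (\sum_(m : matching n | refines r m) #|[set m' | refines r m' & cycle_type m m' == s]|)%N.

Definition refine_count n (r : 'I_(n.*2) -> 'I_(n.*2)) : nat :=
  #|[set m : matching n | refines r m]|.

Lemma refines_conj n (r r' : 'I_(n.*2) -> 'I_(n.*2)) (g : {perm 'I_(n.*2)}) (m : matching n) :
  (forall x y, (r' (g x) == r' (g y)) = (r x == r y)) -> refines r' (act g m) = refines r m.
Proof.
move=> hg; apply/forallP/forallP => h x; first by rewrite -hg -actEg h.
by rewrite -[x](permKV g) actEg hg h.
Qed.

Lemma counts_conj n (r r' : 'I_(n.*2) -> 'I_(n.*2)) (g : {perm 'I_(n.*2)}) :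
  (forall x y, (r' (g x) == r' (g y)) = (r x == r y)) ->
  refine_count r' = refine_count r /\ forall s, cyc_count r' s = cyc_count r s.
Proof.
move=> hg; split=> [|s].
  rewrite /refine_count -[RHS](card_imset _ (@act_inj n g)); apply: eq_card => m.
  rewrite -[m](actKV g) [RHS]mem_imset ?inE ?(refines_conj _ hg) //; exact: act_inj.
rewrite /cyc_count (reindex_inj (@act_inj n g)) /=.
apply: eq_big => m; first exact: refines_conj.
move=> _; rewrite -[RHS](card_imset _ (@act_inj n g)); apply: eq_card => m2.
rewrite -[m2](actKV g) [RHS]mem_imset; last exact: act_inj.
by rewrite !inE cycle_type_act (refines_conj _ hg).
Qed.

Lemma cyc_count_shape_ge n (r : 'I_(n.*2) -> 'I_(n.*2)) v N :
  #|row r (r v)| = N.*2 -> (refine_count r * dfact2 N.-1 <= cyc_count r (shape r))%N.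
Proof.
move=> hN; rewrite /refine_count -sum_nat_const /cyc_count.
under eq_bigl do rewrite inE.
apply: leq_sum => m rm; apply: leq_trans (card_spans_rows_ge rm hN) _.
apply: subset_leq_card; apply/subsetP => m'; rewrite !inE => h.
by rewrite (spans_rows_cycle_type h) eqxx andbT; case/andP: h.
Qed.

Definition long_cycle_const t : nat := (t.*2.+1 * t.+1.*2 ^ t.+1.*2)%N.

(** For fixed [m], each [m'] has one cycle type and so contributes to at most one partition. A fat
    type forces a long component, which [card_long_cycle_le] counts. *)
Lemma cyc_count_fat_le n t (r : 'I_(n.*2) -> 'I_(n.*2)) v N :
  (t.*2 < n)%N -> #|row r (r v)| = N.*2 -> (n - t <= N)%N ->
  (\sum_(l : part n | fatp t l) cyc_count r (ptoseq l)
    <= refine_count r * (long_cycle_const t * dfact2 N.-1))%N.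
Proof.
move=> tn hN ntN; rewrite /cyc_count exchange_big /= /refine_count -sum_nat_const.
under [in X in (_ <= X)%N]eq_bigl do rewrite inE.
apply: leq_sum => m rm; rewrite /long_cycle_const -mulnA [(_ ^ _ * _)%N]mulnC.
apply: leq_trans (card_long_cycle_le tn rm hN ntN).
under eq_bigr do rewrite -sum1_card.
rewrite (exchange_big_dep predT) //= -sum1_card big_mkcond [in X in (_ <= X)%N]big_mkcond /=.
apply: leq_sum => m' _.
have [/existsP[l /andP[hl]]|/existsPn hno] :=
  boolP [exists l : part n, fatp t l && (m' \in [set m' | refines r m' & cycle_type m m' == ptoseq l])].
  rewrite inE => /andP[rm' /eqP e].
  rewrite inE rm' (fatp_long_cycle tn hl e) /= (big_pred1 l) // => l' /=.
  rewrite inE rm' e (inj_eq (@ptoseq_inj n)) /= [l == l']eq_sym.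
  by case: eqP => [->|]; rewrite ?hl // andbF.
rewrite big_pred0 // => l; exact/negbTE.
Qed.

(** At most 2t vertices lie outside the large row, so a refining matching has at most (2t)^(2t)
    restrictions to them, and each restriction prescribes n - N edges. *)
Lemma refine_count_prod n t (r : 'I_(n.*2) -> 'I_(n.*2)) v N :
  #|row r (r v)| = N.*2 -> (n - N <= t)%N ->
  ((\prod_(i < n - N) (n.*2 - i.*2 - 1)) * refine_count r
     <= t.*2 ^ t.*2 * #|[set: matching n]|)%N.
Proof.
move=> hN nt; pose Y := ~: row r (r v).
have cY : #|Y| = (n - N).*2 by rewrite cardsCs setCK card_ord hN; lia.
set P := (\prod_(i < _) _)%N.
have P0 : (0 < P)%N by apply: prodn_gt0 => i; have := ltn_ord i; lia.
have closed s : refines r s -> forall x, x \in Y -> val s x \in Y.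
  by move=> rs x; rewrite !inE (eqP (forallP rs x)).
have : (refine_count r <= t.*2 ^ t.*2 * (#|[set: matching n]| %/ P))%N.
  apply: (@card_le_fibers _ _ _ (restriction Y v)).
    apply: (@leq_trans (#|Y| ^ #|Y|)%N); last by rewrite cY leq_expnn // leq_double.
    by apply: card_restriction_le => s; rewrite inE; apply: closed.
  move=> s; rewrite inE => rs; rewrite leq_divRL // mulnC.
  apply: leq_trans (card_agree_on_prod (closed s rs) cY); rewrite leq_mul2l; apply/orP; right.
  apply: subset_leq_card; apply/subsetP => s'; rewrite inE => /andP[_ /eqP/ffunP h].
  by apply/agree_onP => x xY; have := h x; rewrite !ffunE xY.
move=> h; apply: leq_trans (leq_mul (leqnn P) h) _.
by rewrite mulnCA leq_mul2l mulnC leq_divM orbT.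
Qed.

Lemma dfact2_le_prod n N : (0 < N)%N -> (N <= n)%N ->
  (dfact2 n.-1 <= dfact2 N.-1 * \prod_(i < n - N) (n.*2 - i.*2 - 1))%N.
Proof.
move=> N0 Nn; rewrite -(@dfact2_prod n.-1 (n - N)); last by lia.
have -> : (n.-1 - (n - N) = N.-1)%N by lia.
rewrite mulnC leq_mul2l; apply/orP; right; apply: leq_prod => i _; lia.
Qed.

Lemma odd_prod_mono n k t : (t.*2 < n)%N -> (k <= t)%N ->
  (\prod_(i < k) (n.*2 - i.*2 - 1) <= \prod_(i < t) (n.*2 - i.*2 - 1))%N.
Proof.
move=> tn; elim: t tn => [|t IH] tn; first by rewrite leqn0 => /eqP ->.
rewrite leq_eqVlt => /orP[/eqP ->//|kt].
rewrite [in X in (_ <= X)%N]big_ord_recr /=; apply: leq_trans (IH _ kt) _; first by lia.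
by apply: leq_pmulr; lia.
Qed.

(** * The triangular system *)

Definition target_sum (R : realType) n t (r : 'I_(n.*2) -> 'I_(n.*2)) : R :=
  zeta R n t * (refine_count r)%:R +
  (1 - zeta R n t) * (refine_count r)%:R ^+ 2 / #|[set: matching n]|%:R.

Definition solves (R : realType) n t (x : part n -> R) (r : 'I_(n.*2) -> 'I_(n.*2)) : Prop :=
  \sum_(l | fatp t l) x l * (cyc_count r (ptoseq l))%:R = target_sum R t r.

Lemma solves_defect (R : realType) n t (x : part n -> R) (r : 'I_(n.*2) -> 'I_(n.*2)) :
  solves t x r ->
  \sum_(m1 | refines r m1) \sum_(m2 | refines r m2) defect t x m1 m2 = 0.
Proof.
rewrite /solves /target_sum => h.
under eq_bigr do rewrite /defect !sumrB.
rewrite !sumrB.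
have -> : \sum_(m1 | refines r m1) \sum_(m2 | refines r m2)
    \sum_(l | fatp t l) x l * Aassoc R l m1 m2 =
  \sum_(l | fatp t l) x l * (cyc_count r (ptoseq l))%:R.
  under eq_bigr do rewrite exchange_big.
  rewrite exchange_big /=; apply: eq_bigr => l _.
  rewrite /cyc_count natr_sum mulr_sumr; apply: eq_bigr => m1 _.
  rewrite -mulr_sumr -sum1_card natr_sum; congr (_ * _).
  rewrite big_mkcond [RHS]big_mkcond /=; apply: eq_bigr => m2 _.
  by rewrite inE /Aassoc; case: (refines r m2); case: (_ == _).
rewrite h.
have -> : \sum_(m1 | refines r m1) \sum_(m2 | refines r m2) zeta R n t * (m1 == m2)%:R =
    zeta R n t * (refine_count r)%:R.
  rewrite (eq_bigr (fun=> zeta R n t)); last first.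
    move=> m1 rm; rewrite (bigD1 m1) //= eqxx mulr1 big1 ?addr0 // => m2 /andP[_ hm].
    by rewrite eq_sym (negbTE hm) mulr0.
  by rewrite sumr_const mulr_natr /refine_count cardsE.
rewrite !sumr_const /refine_count cardsE -mulrnA -[_ *+ (_ * _)]mulr_natr natrM; ring.
Qed.

Lemma zeta_bounds (R : realType) n t : (t.*2 < n)%N ->
  `|zeta R n t| <= 1 /\
  `|zeta R n t| * (\prod_(i < t) (n.*2 - i.*2 - 1))%:R <= 2 :> R.
Proof.
move=> tn; rewrite /zeta normrN -natr_prod; set P := (\prod_(i < t) _)%N.
case: t tn @P => [|t] tn P.
  (* For t = 0 the denominator in zeta vanishes, and zeta is 0 by the convention on inverses. *)
  have -> : P = 1%N by rewrite /P big_ord0.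
  by rewrite subrr invr0 normr0 mul0r.
have P2 : (2 <= P)%N.
  have := odd_prod_mono tn (ltn0Sn t); rewrite big_ord1 -/P /= => h; apply: leq_trans h; clear P; lia.
have P2' : (2 : R) <= P%:R by rewrite (ler_nat R 2).
have d0 : 0 < (P%:R : R) - 1 by lra.
rewrite normfV gtr0_norm //; split; first by rewrite invf_le1 //; lra.
by rewrite mulrC ler_pdivrMr //; lra.
Qed.

(** After [refine_count r] is factored out, what remains is at most |zeta| plus twice the proportion
    of refining matchings. Both are of order 1/P for the product P of the n - N leading odd factors,
    and (2n-2)!! is at most P (2N-2)!!. *)
Lemma target_sum_bound (R : realType) n t (r : 'I_(n.*2) -> 'I_(n.*2)) (m : matching n) v N :
  (t.*2 < n)%N -> refines r m -> #|row r (r v)| = N.*2 -> (n - t <= N)%N ->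
  `|target_sum R t r| * (dfact2 n.-1)%:R <=
    (refine_count r * dfact2 N.-1)%:R * (2 + 2 * (t.*2 ^ t.*2)%:R).
Proof.
move=> tn rm hN ntN.
have Nn : (N <= n)%N by rewrite -leq_double -hN -[X in (_ <= X)%N](card_ord n.*2) max_card.
have kt : (n - N <= t)%N by lia.
have [z1 z2] := zeta_bounds R tn.
have h1 : (dfact2 n.-1 <= dfact2 N.-1 * \prod_(i < n - N) (n.*2 - i.*2 - 1))%N.
  by apply: dfact2_le_prod => //; lia.
have h2 := refine_count_prod hN kt.
have h3 := odd_prod_mono tn kt.
move: z1 z2 h1 h2 h3; rewrite /target_sum.
set z := zeta R n t; set P := (\prod_(i < n - N) _)%N; set Q := (\prod_(i < t) _)%N.
set G := dfact2 n.-1; set F := dfact2 N.-1; set a := refine_count r.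
set M := #|[set: matching n]|; set C := (t.*2 ^ t.*2)%N => z1 z2 h1 h2 h3.
have M0 : (0 < M)%N by apply/card_gt0P; exists m; rewrite inE.
rewrite -(ler_nat R) natrM in h1; rewrite -(ler_nat R) !natrM in h2.
rewrite -(ler_nat R) in h3; rewrite -(ltr_nat R) in M0.
rewrite natrM.
have : 0 <= (F%:R : R) by []. have : 0 <= (P%:R : R) by []. have : 0 <= (a%:R : R) by [].
have : 0 <= (C%:R : R) by []. have : 0 <= (G%:R : R) by [].
move: z1 z2 h1 h2 h3 M0; move: (F%:R : R) (P%:R : R) (a%:R : R) (C%:R : R) (M%:R : R) (G%:R : R) (Q%:R : R).
move=> {}F {}P {}a {}C {}M {}G {}Q z1 z2 h1 h2 h3 M0 G0 C0 a0 P0 F0.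
have zP : `|z| * P <= 2 by apply: le_trans (ler_wpM2l (normr_ge0 z) h3) z2.
have aM : P * (a / M) <= C by rewrite mulrA ler_pdivrMr.
have aM0 : 0 <= a / M by apply: divr_ge0 => //; exact: ltW.
have -> : z * a + (1 - z) * a ^+ 2 / M = a * (z + (1 - z) * (a / M)) by field; rewrite gt_eqF.
have T : `|a * (z + (1 - z) * (a / M))| <= a * (`|z| + 2 * (a / M)).
  rewrite normrM (ger0_norm a0) ler_wpM2l //.
  apply: le_trans (ler_normD _ _) _; rewrite lerD2l normrM (ger0_norm aM0) ler_wpM2r //.
  by apply: le_trans (ler_normB _ _) _; rewrite normr1; lra.
apply: le_trans (ler_wpM2r G0 T) _.
have s0 : 0 <= a * (`|z| + 2 * (a / M)).
  by apply: mulr_ge0 => //; apply: addr_ge0 => //; apply: mulr_ge0.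
apply: le_trans (ler_wpM2l s0 h1) _.
have -> : a * (`|z| + 2 * (a / M)) * (F * P) = (a * F) * (`|z| * P + 2 * (P * (a / M))) by ring.
apply: ler_wpM2l; first exact: mulr_ge0.
by apply: lerD => //; rewrite ler_pM2l.
Qed.

Lemma solves_conj (R : realType) n t (x : part n -> R) (r r' : 'I_(n.*2) -> 'I_(n.*2))
    (m m' : matching n) :
  refines r m -> refines r' m' -> shape r = shape r' -> solves t x r -> solves t x r'.
Proof.
move=> rm rm' e; have [g hg] := conj_of_shape rm rm' e.
have [h1 h2] := counts_conj hg.
rewrite /solves /target_sum h1; under [in X in _ -> X = _]eq_bigr do rewrite h2.
by [].
Qed.

Lemma cyc_count_eq0 n (r : 'I_(n.*2) -> 'I_(n.*2)) (s : seq nat) :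
  s <> shape r -> (size s <= size (shape r))%N -> cyc_count r s = 0%N.
Proof.
move=> ne hs; rewrite /cyc_count big1 // => m rm; apply/eqP; rewrite cards_eq0.
apply/eqP/setP => m'; rewrite !inE; apply/negP => /andP[rm' /eqP e].
case: (refines_cycle_type rm rm'); rewrite e // => h.
by move: hs; rewrite leqNgt h.
Qed.

Definition step_const t : nat := (2 + 2 * t.*2 ^ t.*2)%N.

(* The system is triangular in the number of parts: a cycle type occurring for the row
   labelling [r] has more parts than [shape r], or equals it. *)
Lemma solution_step (R : realType) n t d (B : R) (x : part n -> R) : (t.*2 < n)%N -> 0 <= B ->
  (forall l : part n, fatp t l -> `|x l| <= B / (dfact2 n.-1)%:R) ->
  (forall r m (l : part n), refines r m -> fatp t l -> ptoseq l = shape r ->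
     (t.+1 < size (ptoseq l) + d)%N -> solves t x r) ->
  exists x' : part n -> R,
    (forall l : part n, fatp t l ->
      `|x' l| <= (B + ((step_const t)%:R + B * (long_cycle_const t)%:R)) / (dfact2 n.-1)%:R) /\
    (forall r m (l : part n), refines r m -> fatp t l -> ptoseq l = shape r ->
     (t.+1 < size (ptoseq l) + d.+1)%N -> solves t x' r).
Proof.
move=> tn B0 xB xS.
(* The contribution of the partitions with more than [k] parts, whose unknowns are already fixed. *)
pose rest (r : 'I_(n.*2) -> 'I_(n.*2)) k : R :=
  \sum_(l | fatp t l && (k < size (ptoseq l))%N) x l * (cyc_count r (ptoseq l))%:R.
pose good (l : part n) (f : {ffun 'I_(n.*2) -> 'I_(n.*2)}) :=
  [exists m : matching n, refines f m] && (ptoseq l == shape f).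
(* The diagonal equation is solved for one labelling of shape [l], sought among finite functions so
   that [pick] applies; 0 is the default. *)
pose val_at (l : part n) : R := if [pick f | good l f] is Some f then
  (target_sum R t f - rest f (size (ptoseq l))) / (cyc_count f (ptoseq l))%:R else 0.
pose x' (l : part n) := if (size (ptoseq l) + d == t.+1)%N then val_at l else x l.
have G0 : 0 < (dfact2 n.-1)%:R :> R by rewrite ltr0n dfact2_gt0.
have posK (r : 'I_(n.*2) -> 'I_(n.*2)) m (l : part n) : refines r m -> fatp t l -> ptoseq l = shape r ->
    (0 < cyc_count r (ptoseq l))%N.
  move=> rm hl e; have [v [N [hN ntN]]] := fatp_large_row tn hl rm e.
  rewrite e; apply: leq_trans (cyc_count_shape_ge hN); rewrite muln_gt0 dfact2_gt0 andbT.
  by apply/card_gt0P; exists m; rewrite inE.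
exists x'; split=> [l hl|r m l rm hl e hs].
  have [hd|hd] := boolP (size (ptoseq l) + d == t.+1)%N; last first.
    rewrite /x' (negbTE hd); apply: le_trans (xB l hl) _.
    rewrite ler_pM2r ?invr_gt0 // lerDl; apply: addr_ge0 => //; exact: mulr_ge0.
  rewrite /x' hd /val_at; case: pickP => [f /andP[/existsP[m fm] /eqP e]|_]; last first.
    by rewrite normr0; apply: divr_ge0; [apply: addr_ge0 => //; apply: addr_ge0 => //; apply: mulr_ge0 | exact: ltW].
  have [v [N [hN ntN]]] := fatp_large_row tn hl fm e.
  have b1 := target_sum_bound R tn fm hN ntN.
  have K1 := cyc_count_shape_ge hN; rewrite -e in K1.
  have KK := cyc_count_fat_le tn hN ntN.
  have K0 : 0 < (cyc_count f (ptoseq l))%:R :> R by rewrite ltr0n (posK _ _ _ fm hl e).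
  set aF := (refine_count f * dfact2 N.-1)%N in K1 b1.
  rewrite mulnCA -/aF in KK.
  have rb : `|rest f (size (ptoseq l))| * (dfact2 n.-1)%:R <= B * (long_cycle_const t * aF)%:R.
    rewrite -ler_pdivlMr // mulrAC.
    apply: (@le_trans _ _ (B / (dfact2 n.-1)%:R * (\sum_(l' | fatp t l') cyc_count f (ptoseq l'))%:R)).
      rewrite /rest; apply: le_trans (ler_norm_sum _ _ _) _.
      rewrite natr_sum mulr_sumr [in leLHS]big_mkcondr /=; apply: ler_sum => l' hl'.
      have T : `|x l' * (cyc_count f (ptoseq l'))%:R| <=
          B / (dfact2 n.-1)%:R * (cyc_count f (ptoseq l'))%:R.
        by rewrite normrM normr_nat ler_wpM2r // xB.
      by case: ifP => // _; apply: mulr_ge0 => //; apply: divr_ge0 => //; exact: ltW.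
    apply: ler_wpM2l; first by apply: divr_ge0 => //; exact: ltW.
    by rewrite ler_nat.
  (* The numerator is at most a constant times [aF] and the diagonal coefficient is at least [aF],
     so the quotient is bounded in terms of t and [B]. *)
  rewrite normrM normfV (gtr0_norm K0) ler_pdivrMr // mulrAC ler_pdivlMr //.
  have b2 : (aF%:R : R) <= (cyc_count f (ptoseq l))%:R by rewrite ler_nat.
  apply: (@le_trans _ _ ((`|target_sum R t f| + `|rest f (size (ptoseq l))|) * (dfact2 n.-1)%:R)).
    by apply: ler_wpM2r; [exact: ltW | exact: ler_normB].
  rewrite mulrDl; apply: le_trans (lerD b1 rb) _.
  rewrite natrM /step_const natrD natrM.
  set c := (_ ^ _)%:R; set L := (long_cycle_const t)%:R.
  have -> : aF%:R * (2 + 2 * c) + B * (L * aF%:R) = (2 + 2 * c + B * L) * aF%:R by ring.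
  have c0 : 0 <= c :> R by [].
  have L0 : 0 <= L :> R by [].
  apply: le_trans (ler_wpM2l _ b2) _.
    by apply: addr_ge0; [apply: addr_ge0 => //; apply: mulr_ge0 | apply: mulr_ge0].
  by apply: ler_wpM2r; [exact: ltW | rewrite lerDr].
have split_sum (f : 'I_(n.*2) -> 'I_(n.*2)) k m0 : refines f m0 -> ptoseq l = shape f -> size (ptoseq l) = k ->
    \sum_(l' | fatp t l') x' l' * (cyc_count f (ptoseq l'))%:R =
    x' l * (cyc_count f (ptoseq l))%:R +
    \sum_(l' | fatp t l' && (k < size (ptoseq l'))%N) x' l' * (cyc_count f (ptoseq l'))%:R.
  move=> fm ef ek; rewrite (bigD1 l) //=; congr (_ + _).
  rewrite big_mkcondr [RHS]big_mkcondr /=; apply: eq_bigr => l' hl'.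
  have [->|ne] := eqVneq l' l; first by rewrite ek ltnn.
  case: ltnP => // h; rewrite cyc_count_eq0 ?mulr0 //.
    by rewrite -ef => /(@ptoseq_inj n) e'; rewrite e' eqxx in ne.
  by rewrite -ef ek.
have xx l' : (t.+1 < size (ptoseq l') + d)%N -> x' l' = x l'.
  by move=> h; rewrite /x' gtn_eqF.
have [hd|hd] := eqVneq (size (ptoseq l) + d)%N t.+1; last first.
  have hd' : (t.+1 < size (ptoseq l) + d)%N by rewrite ltn_neqAle eq_sym hd; lia.
  have := xS r m l rm hl e hd'; rewrite /solves => <-.
  apply: eq_bigr => l' hl'.
  have [h|h] := ltnP t.+1 (size (ptoseq l') + d)%N; first by rewrite xx.
  rewrite cyc_count_eq0 ?mulr0 //; rewrite -e; last by lia.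
  by move=> /(congr1 size) e'; move: h; rewrite e' leqNgt hd'.
have [f [/andP[/existsP[m0 fm] /eqP ef] vE]] : exists f, good l f /\ val_at l =
    (target_sum R t f - rest f (size (ptoseq l))) / (cyc_count f (ptoseq l))%:R.
  (* The search succeeds because [r], turned into a finite function, is itself a candidate. *)
  rewrite /val_at; case: pickP => [f hf|/(_ [ffun x => r x])]; first by exists f.
  have rE : [ffun x => r x] =1 r by move=> y; rewrite ffunE.
  move=> /negbT /negP []; apply/andP; split.
    by apply/existsP; exists m; apply/forallP => y; rewrite !rE; exact: (forallP rm).
  have rowE i : row [ffun x => r x] i = row r i by apply/setP => y; rewrite !inE rE.
  rewrite e; apply/eqP; rewrite /shape; suff -> : rows [ffun x => r x] = rows r by [].
  by apply: eq_imset => y; rewrite rE rowE.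
apply: (@solves_conj _ _ _ _ f r m0 m) => //; first by rewrite -ef -e.
rewrite /solves (split_sum f _ m0 fm ef erefl) {1}/x' hd eqxx vE divfK; last first.
  by rewrite pnatr_eq0 -lt0n (posK _ _ _ fm hl ef).
rewrite /rest [X in _ + X](eq_bigr (fun l' => x l' * (cyc_count f (ptoseq l'))%:R)) ?subrK //.
by move=> l' /andP[_ h]; rewrite xx //; lia.
Qed.

Lemma solution_exists (R : realType) t d : exists B : R, 0 < B /\
  forall n, (t.*2 < n)%N -> exists x : part n -> R,
    (forall l : part n, fatp t l -> `|x l| <= B / (dfact2 n.-1)%:R) /\
    (forall r m (l : part n), refines r m -> fatp t l -> ptoseq l = shape r ->
     (t.+1 < size (ptoseq l) + d)%N -> solves t x r).
Proof.
elim: d => [|d [B [B0 IH]]].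
  exists 1; split=> // n tn; exists (fun=> 0); split=> [l _|r m l _ hl _].
    by rewrite normr0 divr_ge0.
  (* The initial equations are vacuous: a fat partition has at most t + 1 parts. *)
  have n0 : (0 < n)%N by lia.
  have tn' : (t < n)%N by lia.
  have i00 : Ordinal n0 = 0%N :> nat by [].
  have := fat_parts_size tn' i00 (fatp_parts tn' i00 hl).
  by rewrite addn0 ltnNge => ->.
exists (B + ((step_const t)%:R + B * (long_cycle_const t)%:R)); split.
  by apply: ltr_wpDr => //; apply: addr_ge0 => //; apply: mulr_ge0 => //; exact: ltW.
move=> n tn; have [x [xB xS]] := IH n tn.
exact: (solution_step tn (ltW B0) xB xS).
Qed.

Theorem mainTheorem4 (R : realType) (t : nat) :
  exists B : R, 0 < B /\
  forall n : nat, (t.*2 < n)%N ->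
  exists x : part n -> R,
    (forall r : part n, fatp t r -> `|x r| <= B / (dfact2 n.-1)%:R) /\
    (forall l : part n, fatp t l ->
       forall v : matching n -> R, inS l v ->
       forall m : matching n, Atilde t x v m = eta_target R t l * v m).
Proof.
have [B [B0 H]] := solution_exists R t t.+2.
exists B; split=> // n tn; have [x [xB xS]] := H n tn.
exists x; split=> //; apply: Atilde_eigen => // r wr [m rm].
have [l hl] := shape_part rm.
(* With [d = t + 2] the condition on the number of parts always holds. *)
apply: solves_defect; apply: (xS r m l rm (wide_fatp tn wr rm hl) hl); lia.
Qed.
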